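(* Let $\sigma$ be a partition of the set of all primes, and let $1\neq G=AB=BC=AC$ be a finite group, where $A$, $B$ and $C$ are $\sigma$-soluble subgroups of $G$. Then the following statements hold. (1) If $G$ is $\sigma$-soluble, then $\Gamma_{\mathfrak{N}_\sigma}(A)\cup\Gamma_{\mathfrak{N}_\sigma}(B)\cup\Gamma_{\mathfrak{N}_\sigma}(C)=\Gamma_{\mathfrak{N}_\sigma}(G)$. (2) If the indices $|G:A|$, $|G:B|$, $|G:C|$ are pairwise $\sigma$-coprime, then $\Gamma_{H\sigma}(A)\cup\Gamma_{H\sigma}(B)\cup\Gamma_{H\sigma}(C)=\Gamma_{H\sigma}(G)$.
   Context: All groups are finite. $\mathbb{P}$ is the set of all primes, $\pi(n)$ is the set of primes dividing the integer $n$, and $\pi(G)=\pi(|G|)$. $\sigma=\{\sigma_i\mid i\in I\}$ is a partition of $\mathbb{P}$: $\mathbb{P}=\bigcup_{i\in I}\sigma_i$ and $\sigma_i\cap\sigma_j=\emptyset$ for $i\ne j$. Put $\sigma(n)=\{\sigma_i\mid \sigma_i\cap\pi(n)\neq\emptyset\}$ and $\sigma(G)=\sigma(|G|)$. Integers $n$ and $m$ are $\sigma$-coprime if $\sigma(n)\cap\sigma(m)=\emptyset$. For a set of primes $\pi$, a $\pi$-group is a group $X$ with $\pi(X)\subseteq\pi$. A chief factor $H/K$ of $G$ is $\sigma$-central in $G$ if for some $i$ both $H/K$ and $G/C_G(H/K)$ are $\sigma_i$-groups. $G$ is: $\sigma$-soluble if every chief factor of $G$ is a $\sigma_i$-group for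 some $i$ (depending on the factor); $\sigma$-nilpotent if every chief factor of $G$ is $\sigma$-central in $G$; $\{\sigma_i\}$-nilpotent if every chief factor $H/K$ of $G$ with $\pi(H/K)\cap\sigma_i\neq\emptyset$ is $\sigma$-central in $G$. $F_{\{\sigma_i\}}(G)$ is the largest normal $\{\sigma_i\}$-nilpotent subgroup of $G$. $\mathfrak{N}_\sigma$ is the class of all $\sigma$-nilpotent groups; an $\mathfrak{N}_\sigma$-critical group is a non-$\sigma$-nilpotent group all of whose proper subgroups are $\sigma$-nilpotent. For a group $X$, the following are directed graphs with vertex set $\sigma(X)$ (for $X=1$ this is the empty graph). $\Gamma_{H\sigma}(X)$ ($\sigma$-Hawkes graph): $(\sigma_i,\sigma_j)$ is an edge iff $\sigma_j\in\sigma(X/F_{\{\sigma_i\}}(X))$. $\Gamma_{\mathfrak{N}_\sigma}(X)$ ($\sigma$-Vasil'ev-Murashko graph): $(\sigma_i,\sigma_j)$ is an edge iff for some $\mathfrak{N}_\sigma$-critical subgroup $H$ of $X$ we have $\sigma_i\in\sigma(H)$ and $\sigma_j\in\sigma(H/F_{\{\sigma_i\}}(H))$. The union of graphs has as vertex set (edge set) the union of the vertex sets (edge sets). *)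

(* Defs.v *)
From HB Require Import structures.
From mathcomp Require Import all_boot all_fingroup all_solvable.
From mathcomp Require Import boolp classical_sets.

Set Implicit Arguments.
Unset Strict Implicit.
Unset Printing Implicit Defensive.

Local Open Scope classical_set_scope.
Local Open Scope group_scope.

(* A partition of the set of primes is a family of blocks [sigma : I -> nat_pred]
   over an arbitrary index type. A block is represented by its index: the blocks
   meeting some \pi(n) are nonempty, so disjointness makes i |-> sigma i
   injective on all the indices that ever occur as vertices below. *)
Definition prime_partition (I : Type) (sigma : I -> nat_pred) : Prop :=
  (forall p : nat, prime p <-> exists i : I, p \in sigma i) /\
  (forall i j : I, i <> j -> [predI sigma i & sigma j] =i pred0).

Definition sigma_set (I : Type) (sigma : I -> nat_pred) (n : nat) : set I :=
  [set i | exists2 p : nat, p \in \pi(n) & p \in sigma i].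

Definition sigma_coprime (I : Type) (sigma : I -> nat_pred) (n m : nat) : Prop :=
  sigma_set sigma n `&` sigma_set sigma m = set0.

(* MathComp's [chief_factor G K H] says that H / K is a chief factor of G
   (the smaller group comes first). *)

Definition sigma_central (I : Type) (sigma : I -> nat_pred)
    (gT : finGroupType) (G H K : {group gT}) : Prop :=
  exists i : I,
    (sigma i).-group (H / K) /\ (sigma i).-group (G / 'C_G(H / K | 'Q)).

Definition sigma_soluble (I : Type) (sigma : I -> nat_pred)
    (gT : finGroupType) (G : {group gT}) : Prop :=
  forall H K : {group gT}, chief_factor G K H ->
    exists i : I, (sigma i).-group (H / K).

Definition sigma_nilpotent (I : Type) (sigma : I -> nat_pred)
    (gT : finGroupType) (G : {group gT}) : Prop :=
  forall H K : {group gT}, chief_factor G K H -> sigma_central sigma G H K.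

Definition block_nilpotent (I : Type) (sigma : I -> nat_pred) (i : I)
    (gT : finGroupType) (G : {group gT}) : Prop :=
  forall H K : {group gT}, chief_factor G K H ->
    sigma_set sigma #|H / K| i -> sigma_central sigma G H K.

(* F = F_{sigma_i}(G), as a definite description: such an F is unique by
   antisymmetry of inclusion. *)
Definition is_block_Fitting (I : Type) (sigma : I -> nat_pred) (i : I)
    (gT : finGroupType) (G F : {group gT}) : Prop :=
  [/\ F <| G, block_nilpotent sigma i F &
      forall N : {group gT},
        N <| G -> block_nilpotent sigma i N -> N \subset F].

Definition sigma_nilpotent_critical (I : Type) (sigma : I -> nat_pred)
    (gT : finGroupType) (H : {group gT}) : Prop :=
  ~ sigma_nilpotent sigma H /\
  forall K : {group gT}, K \proper H -> sigma_nilpotent sigma K.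

Record digraph (V : Type) := Digraph {
  vertices : set V;
  edges : set (V * V)
}.

Definition digraph_union (V : Type) (g h : digraph V) : digraph V :=
  Digraph (vertices g `|` vertices h) (edges g `|` edges h).

Definition Hawkes_graph (I : Type) (sigma : I -> nat_pred)
    (gT : finGroupType) (X : {group gT}) : digraph I :=
  let V := sigma_set sigma #|X| in
  Digraph V
    [set ij | [/\ V ij.1, V ij.2 &
       exists2 F : {group gT}, is_block_Fitting sigma ij.1 X F &
         sigma_set sigma #|X / F| ij.2]].

Definition Vasilev_Murashko_graph (I : Type) (sigma : I -> nat_pred)
    (gT : finGroupType) (X : {group gT}) : digraph I :=
  let V := sigma_set sigma #|X| in
  Digraph V
    [set ij | [/\ V ij.1, V ij.2 &
       exists H : {group gT},
         [/\ H \subset X, sigma_nilpotent_critical sigma H,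
             sigma_set sigma #|H| ij.1 &
             exists2 F : {group gT}, is_block_Fitting sigma ij.1 H F &
               sigma_set sigma #|H / F| ij.2]]].

(* Main.v *)
Require Import Defs.
From mathcomp Require Import all_boot all_fingroup all_solvable.
From mathcomp Require boolp classical_sets ssralg integral_char.

(** Over a partition sigma, {sigma_i}-nilpotency of G means that G / O_{i'}(G) is
    a sigma_i-group, so F_{sigma_i}(G) = O_{i',i}(G).

    (2) G is sigma-soluble: if N = O_{sigma_i}(A) <> 1, one of |G : B|, |G : C| is
    a sigma_i'-number, say the former; then N <= B, whence N^G = N^B <= B, and one
    passes to G / N^G. For an edge (sigma_i, sigma_j) of G two of the three factors,
    say A and B, have sigma_i'-index. Modulo O_{i'}(G), the subgroup P = O_i(G) lies
    in A and B and contains its centraliser, so F_i(A) = O_i(A) and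
    F_i(B) = O_i(B). If neither A nor B has the edge, then either i <> j and A, B,
    hence G, are sigma_j'-groups, or i = j and O_i(A) = O_i(B) is a normal Hall
    subgroup of G.

    (1) (sigma_i, sigma_j) is an edge of a sigma-soluble X iff i <> j and for some
    p in sigma_i, q in sigma_j a q-subgroup of X normalises but does not centralise
    a p-subgroup of X. Chief factors are p'- or q'-groups, so Hall {p,q}-subgroups
    exist and dominate the {p,q}-subgroups; this reduces the claim to a
    {p,q}-group E = AB = BC = AC. There, absence of such pairs means that the Sylow
    q-subgroup is normal, and a trace argument on an abelian normal p-subgroup
    passes this property from A, B and C to E. *)

Set Implicit Arguments.
Unset Strict Implicit.
Unset Printing Implicit Defensive.
Local Open Scope group_scope.

(** * Subnormal series with sigma-primary factors, and sigma-solubility *)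

Section PrimarySeries.

Variables (I : Type) (sigma : I -> nat_pred).

(** Each term is normal only in the next one, so the notion passes easily to subgroups, quotients
    and extensions, unlike a condition on chief factors. The family [sigma] is arbitrary here, which
    allows other choices of classes of primes later. *)
Inductive primary_series (gT : finGroupType) : {group gT} -> Prop :=
  | primary_series1 : primary_series 1%G
  | primary_seriesS (K H : {group gT}) (i : I) :
      primary_series K -> K <| H -> (sigma i).-nat #|H : K| ->
      primary_series H.

Lemma index_dvd_normal (gT : finGroupType) (A H K : {group gT}) :
  K <| H -> A \subset H -> #|A : K| %| #|H : K|.
Proof.
case/andP=> _ nKH sAH; rewrite -!card_quotient ?(subset_trans sAH) //.
by rewrite cardSg ?quotientS.
Qed.

Lemma primary_series_sub (gT : finGroupType) (H L : {group gT}) :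
  primary_series H -> L \subset H -> primary_series L.
Proof.
move=> serH; elim: serH L => [L|K {}H i _ IH nKH iHK L sLH].
  by move/trivGP->; apply: primary_series1.
apply: (@primary_seriesS _ (L :&: K)%G _ i); first by apply: IH; rewrite subsetIr.
  by rewrite /= (normalGI sLH).
rewrite indexgI; exact: pnat_dvd (index_dvd_normal nKH sLH) iHK.
Qed.

Lemma primary_series_quotient (gT : finGroupType) (H N : {group gT}) :
  primary_series H -> H \subset 'N(N) -> primary_series (H / N)%G.
Proof.
elim=> [_|K {}H i _ IH nKH iHK nNH].
  have -> : (1%G / N)%G = 1%G by apply: group_inj; rewrite /= quotient1.
  exact: primary_series1.
have sKH := normal_sub nKH.
apply: (@primary_seriesS _ (K / N)%G _ i); first exact: IH (subset_trans _ nNH).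
  exact: quotient_normal.
by apply: morphim_p_index => //; apply: subset_trans nNH.
Qed.

Lemma primary_series_ext (gT : finGroupType) (H N : {group gT}) :
  N <| H -> primary_series N -> primary_series (H / N)%G -> primary_series H.
Proof.
move=> nNH serN serQ.
suff: forall X : {group coset_of N}, primary_series X ->
    primary_series (coset N @*^-1 X)%G.
  move/(_ _ serQ); congr primary_series; apply: group_inj => /=.
  by rewrite quotientGK.
move=> X; elim=> [|K L i _ IH nKL iLK].
  by move: serN; congr primary_series; apply: group_inj; exact: esym (ker_coset N).
apply: (@primary_seriesS _ (coset N @*^-1 K)%G _ i) => //.
  by rewrite cosetpre_normal.
by rewrite index_morphpre // im_coset.
Qed.

(** The first non-trivial term is a sigma_i-group. A non-trivial O_i(K) is characteristic in K,
    hence normal in the next term, and so it survives up to H. *)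
Lemma primary_series_pcore (gT : finGroupType) (H : {group gT}) :
  primary_series H -> H :!=: 1 -> exists i, 'O_(sigma i)(H) != 1.
Proof.
elim=> [|K {}H i _ IH nKH iHK ntH]; first by rewrite eqxx.
have [K1 | ntK] := eqVneq (K : {set gT}) 1.
  exists i; rewrite pcore_pgroup_id // /pgroup -indexg1 -K1 //.
have [j ntj] := IH ntK; exists j; apply: subG1_contra ntj.
apply: pcore_max (pcore_pgroup _ _) _.
exact: char_normal_trans (pcore_char _ _) nKH.
Qed.

(** A series may repeat terms, so the last proper step has to be searched for. *)
Lemma primary_series_maxnormal (gT : finGroupType) (H : {group gT}) :
  primary_series H -> H :!=: 1 ->
  exists K : {group gT},
    [/\ K <| H, K \proper H & exists i, (sigma i).-nat #|H : K|].
Proof.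
elim=> [|K {}H i _ IH nKH iHK ntH]; first by rewrite eqxx.
have [defK | neKH] := eqVneq (K : {set gT}) H.
  by rewrite -(group_inj defK); apply: IH; rewrite defK.
by exists K; split; rewrite ?properEneq ?neKH ?normal_sub //; exists i.
Qed.

(** Forwards, a normal subgroup N of G is refined by a maximal G-invariant proper subgroup K, and N
    / K is a chief factor. Backwards, H / K has some non-trivial O_i, which is characteristic, so
    minimality of H / K in G / K makes it everything. *)
Lemma sigma_soluble_primary_series (gT : finGroupType) (G : {group gT}) :
  sigma_soluble sigma G <-> primary_series G.
Proof.
split=> [solG | serG H K chiefHK].
  suff serN n (N : {group gT}) : #|N| <= n -> N <| G -> primary_series N.
    exact: serN (leqnn _) (normal_refl G).
  elim: n N => [|n IH] N leNn nNG; first by rewrite leqNgt cardG_gt0 in leNn.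
  have [/group_inj-> | ntN] := eqVneq (N : {set gT}) 1.
    exact: primary_series1.
  have [K maxK _] : {K : {group gT} | maxnormal K N G & 1%G \subset K}.
    by apply: maxgroup_exists; rewrite proper1G ntN norms1.
  have /andP[ltKN nKG] := maxgroupp maxK.
  have sKN := proper_sub ltKN; have sNG := normal_sub nNG.
  have [|i iNK] := solG N K; first by rewrite /chief_factor maxK.
  have nKN : K <| N by rewrite /normal sKN (subset_trans sNG).
  apply: (@primary_seriesS _ K _ i) => //.
    apply: IH; last by rewrite /normal (subset_trans sKN).
    by rewrite -ltnS (leq_trans (proper_card ltKN)).
  by rewrite -card_quotient ?normal_norm.
have /andP[maxK nHG] := chiefHK.
have /andP[ltKH nKG] := maxgroupp maxK.
have /mingroupP[/andP[ntHK _] minHK] := chief_factor_minnormal chiefHK.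
have sHG := normal_sub nHG.
have serHK : primary_series (H / K)%G.
  apply: primary_series_quotient (subset_trans sHG nKG).
  exact: primary_series_sub serG sHG.
have [i ntO] := primary_series_pcore serHK ntHK.
exists i; rewrite -(minHK 'O_(sigma i)(H / K)%G) ?pcore_pgroup ?pcore_sub //.
rewrite ntO /=; apply: subset_trans (char_norms (pcore_char _ _)).
exact: quotient_norms (normal_norm nHG).
Qed.

End PrimarySeries.

(** Serves to coarsen the partition to a set of primes and its complement, and to pass to the
    overlapping classes p' and q'. *)
Lemma primary_series_weaken (I J : Type) (sigma : I -> nat_pred)
    (tau : J -> nat_pred) (gT : finGroupType) (G : {group gT}) :
  (forall i, exists j, {subset sigma i <= tau j}) ->
  primary_series sigma G -> primary_series tau G.
Proof.
move=> sub_st; elim=> [|K H i _ IH nKH iHK]; first exact: primary_series1.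
have [j sub_ij] := sub_st i; apply: primary_seriesS IH nKH _.
exact: sub_in_pnat (fun p _ => @sub_ij p) iHK.
Qed.

(** * Groups with a normal pi-complement, and the subgroup O_{pi',pi} *)

Section PiNilpotent.

Variable pi : nat_pred.
Implicit Types gT : finGroupType.

Definition pi_nilpotent gT (G : {group gT}) := pi.-nat #|G : 'O_pi^'(G)|.

Lemma pi_nilpotentI gT (G K : {group gT}) :
  K <| G -> pi^'.-group K -> pi.-nat #|G : K| -> pi_nilpotent G.
Proof. by move=> nKG piK; apply: pnat_dvd (indexgS G (pcore_max piK nKG)). Qed.

Lemma pi_nilpotent_sub gT (G L : {group gT}) :
  pi_nilpotent G -> L \subset G -> pi_nilpotent L.
Proof.
move=> nilG sLG; apply: (@pi_nilpotentI _ _ (L :&: 'O_pi^'(G))%G).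
- exact: normalGI sLG (pcore_normal _ _).
- exact: pgroupS (subsetIr _ _) (pcore_pgroup _ _).
- by rewrite /= indexgI; apply: pnat_dvd (index_dvd_normal (pcore_normal _ _) sLG) _.
Qed.

Lemma pi_nilpotent_quotient gT (G N : {group gT}) :
  G \subset 'N(N) -> pi_nilpotent G -> pi_nilpotent (G / N).
Proof.
move=> nNG nilG; apply: (@pi_nilpotentI _ _ ('O_pi^'(G) / N)%G).
- exact: quotient_normal (pcore_normal _ _).
- exact: quotient_pgroup (pcore_pgroup _ _).
- exact: morphim_p_index (subset_trans (pcore_sub _ _) nNG) nilG.
Qed.

Lemma pi_nilpotent_mod gT (G W : {group gT}) :
  W <| G -> pi^'.-group W -> pi_nilpotent (G / W) -> pi_nilpotent G.
Proof.
move=> nWG pi'W; rewrite /pi_nilpotent pquotient_pcore //.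
rewrite index_quotient_eq ?pcore_sub ?normal_norm //.
by rewrite (subset_trans (subsetIr _ _)) // pcore_max.
Qed.

(* By Schur-Zassenhaus the normal Hall pi-subgroup Z(N) of C_K(N) has a
   complement there, which is normal because Z(N) is central. *)
Lemma central_Hall_pi_nilpotent gT (K N : {group gT}) :
  N <| K -> pi.-group N -> pi^'.-nat #|K : N| -> pi.-nat #|K : 'C_K(N)| ->
  pi_nilpotent K.
Proof.
move=> nNK piN pi'KN piKC; have [sNK nNK'] := andP nNK.
pose C := 'C_K(N)%G; rewrite -[X in #|_ : X|]/(gval C) in piKC.
have sCK : C \subset K by rewrite subsetIl.
have nCK : C <| K by rewrite /normal subsetIl normsI ?normG ?norms_cent.
pose Z := (C :&: N)%G.
have nZC : Z <| C by rewrite /normal subsetIl normsI ?normG ?(subset_trans sCK).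
have piZ : pi.-group Z := pgroupS (subsetIr _ _) piN.
have pi'CZ : pi^'.-nat #|C : Z|.
  by rewrite indexgI; apply: pnat_dvd (index_dvd_normal nNK sCK) pi'KN.
have hallZ : pi.-Hall(C) Z by rewrite pHallE normal_sub //=; apply/eqP;
   rewrite -(Lagrange (normal_sub nZC)) partnM // part_pnat_id // part_p'nat ?muln1.
have [L] := splitsP (SchurZassenhaus_split (pHall_Hall hallZ) nZC).
case/complP=> tiZL defC.
have sLC : L \subset C by rewrite -defC mulG_subr.
have nLC : L <| C.
  rewrite /normal sLC -defC mulG_subG normG andbT.
  rewrite cents_norm // centsC (subset_trans sLC) //.
  by rewrite (subset_trans (subsetIr _ _)) ?centS ?subsetIr.
have cardC : #|C| = (#|Z| * #|L|)%N by rewrite -defC TI_cardMg.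
have pi'L : pi^'.-group L.
  by move: pi'CZ; rewrite -divgS ?normal_sub // cardC mulKn.
have piCL : pi.-nat #|C : L|.
  by rewrite -divgS // cardC mulnK.
have hallL : pi^'.-Hall(C) L by rewrite /pHall sLC pi'L pnatNK.
have nLK : L <| K.
  by rewrite -(normal_Hall_pcore hallL nLC) (char_normal_trans (pcore_char _ _)).
apply: (pi_nilpotentI nLK pi'L).
by rewrite -(Lagrange_index sCK sLC) pnatM piKC.
Qed.

Definition pi_Fitting gT (G : {group gT}) := 'O_{pi^', pi}(G).

Canonical pi_Fitting_group gT (G : {group gT}) := [group of pi_Fitting G].

Lemma pi_Fitting_normal gT (G : {group gT}) : pi_Fitting G <| G.
Proof. exact: pseries_normal. Qed.

Lemma pcore_sub_pi_Fitting gT (G : {group gT}) : 'O_pi^'(G) \subset pi_Fitting G.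
Proof. by rewrite /pi_Fitting -pseries1 (pseries_sub_catl [:: _] [:: _]). Qed.

Lemma quotient_pi_Fitting gT (G : {group gT}) :
  pi_Fitting G / 'O_pi^'(G) = 'O_pi(G / 'O_pi^'(G)).
Proof. exact: quotient_pseries2. Qed.

Lemma pi_Fitting_nilpotent gT (G : {group gT}) : pi_nilpotent (pi_Fitting G).
Proof.
have sF := pcore_sub_pi_Fitting G; have nFG := pi_Fitting_normal G.
apply: (@pi_nilpotentI _ _ 'O_pi^'(G)%G) (pcore_pgroup _ _) _.
  by rewrite (normalS sF (normal_sub nFG)) ?pcore_normal.
rewrite -card_quotient ?quotient_pi_Fitting; first exact: pcore_pgroup.
by rewrite (subset_trans (normal_sub nFG)) ?gFnorm.
Qed.

(** O_{pi'}(N) is characteristic in N, so it lies in O_{pi'}(G); hence N becomes a normal pi-group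
    modulo O_{pi'}(G). *)
Lemma pi_Fitting_max gT (G N : {group gT}) :
  N <| G -> pi_nilpotent N -> N \subset pi_Fitting G.
Proof.
move=> nNG nilN; have nOG : G \subset 'N('O_pi^'(G)) := gFnorm _ _.
have nON := subset_trans (normal_sub nNG) nOG.
rewrite -(quotientSGK nON (pcore_sub_pi_Fitting G)) quotient_pi_Fitting.
apply: pcore_max (quotient_normal _ nNG).
rewrite /pgroup card_quotient //; apply: pnat_dvd nilN.
apply: indexgS; apply: pcore_max (pcore_pgroup _ _) _.
exact: char_normal_trans (pcore_char _ _) nNG.
Qed.

Lemma pi_Fitting_id gT (G : {group gT}) : (pi_Fitting G == G) = pi_nilpotent G.
Proof.
apply/eqP/idP => [defF | nilG].
  have <- : pi_Fitting_group G = G := group_inj defF.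
  exact: pi_Fitting_nilpotent.
by apply/eqP; rewrite eqEsubset (normal_sub (pi_Fitting_normal G)) pi_Fitting_max.
Qed.

End PiNilpotent.

(** * From conditions on chief factors to normal complements *)

Lemma sigma_setE (I : Type) (sigma : I -> nat_pred) n i :
  0 < n -> sigma_set sigma n i <-> ~~ (sigma i)^'.-nat n.
Proof.
move=> n_gt0; split=> [[p pn psi] | ].
  by apply/negP => /pnatPpi/(_ pn); rewrite inE /= psi.
rewrite /pnat n_gt0 /= => /allPn[p pn]; rewrite inE /= negbK => psi.
by exists p.
Qed.

(** The induction descends a chief series from G to 1, so that [R] can speak of the quotient G /
    N. *)
Lemma chief_series_ind (gT : finGroupType) (G : {group gT}) (R : {group gT} -> Prop) :
  R G ->
  (forall N H : {group gT}, chief_factor G N H -> N <| G -> R H -> R N) ->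
  R 1%G.
Proof.
move=> RG step; have [s chief_s lastG] := chief_series_exists (normal_refl G).
have: (1%G : {group gT}) <| G by exact: normal1.
elim: s (1%G : {group gT}) chief_s lastG => [|H s IH] N /=; first by move=> _ ->.
case/andP=> chiefNH chief_s lastG nNG; apply: (step N H) => //.
by apply: IH => //; case/andP: chiefNH.
Qed.

Section Partition.

Variables (I : Type) (sigma : I -> nat_pred).
Hypothesis sigma_part : prime_partition sigma.
Implicit Types gT : finGroupType.

Lemma block_inj p i j : p \in sigma i -> p \in sigma j -> i = j.
Proof.
move=> pi pj; apply: boolp.contrapT => /(proj2 sigma_part)/(_ p).
by rewrite !inE /= pi pj.
Qed.

Lemma block_disjoint i j : i <> j -> {subset sigma i <= (sigma j)^'}.
Proof. by move=> ne_ij p pi; rewrite inE /=; apply/negP => /(block_inj pi). Qed.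

Lemma sigma_set_block i j n :
  0 < n -> (sigma i).-nat n -> sigma_set sigma n j -> i = j.
Proof.
move=> n_gt0 in_ [p pn pj]; apply: block_inj pj.
by rewrite (pnatPpi in_).
Qed.

Lemma normal_astabQ gT (G H N : {group gT}) :
  G \subset 'N(N) -> G \subset 'N(H) -> 'C_G(H / N | 'Q) <| G.
Proof.
move=> nNG nHG; rewrite /normal subsetIl normsI ?normG //.
by rewrite astabQ norm_quotient_pre ?norms_cent ?quotient_norms.
Qed.

(* R N says that G / N is sigma_i-nilpotent. *)
Lemma block_nilpotent_pi_nilpotent gT i (G : {group gT}) :
  block_nilpotent sigma i G -> pi_nilpotent (sigma i) G.
Proof.
move=> nilG; pose R (N : {group gT}) := exists K : {group gT},
  [/\ N \subset K, K <| G, (sigma i)^'.-nat #|K : N| & (sigma i).-nat #|G : K|].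
suff [K [_ nKG pi'K piGK]] : R 1%G.
  by apply: pi_nilpotentI nKG _ piGK; rewrite /pgroup -indexg1.
apply: (chief_series_ind (G := G)); first by exists G; rewrite subxx normal_refl indexgg.
move=> N H chiefNH nNG [K [sHK nKG pi'K piGK]].
have [/maxgroupp/andP[ltNH nNG'] nHG] := andP chiefNH.
have sNH := proper_sub ltNH; have sHG := normal_sub nHG.
have sNK := subset_trans sNH sHK; have nNK := subset_trans (normal_sub nKG) nNG'.
have nNH := subset_trans sHG nNG'.
have [pi'HN | /sigma_setE iHN] := boolP ((sigma i)^'.-nat #|H / N|).
  exists K; split=> //.
  by rewrite -(Lagrange_index sHK sNH) pnatM pi'K -card_quotient.
have [k [kHN kGC]] := nilG H N chiefNH (iHN (cardG_gt0 _)).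
have ik : k = i := sigma_set_block (cardG_gt0 _) kHN (iHN (cardG_gt0 _)).
rewrite {k}ik in kHN kGC.
have nCG := normal_astabQ nNG' (normal_norm nHG).
set C := 'C_G(_ | _) in kGC nCG.
rewrite /pgroup card_quotient ?normal_norm // in kGC.
(* H / N is a normal Hall sigma_i-subgroup of K / N whose centraliser has sigma_i-index. The
   resulting normal complement is pulled back to [L], which takes the place of K one chief factor
   further down. *)
have nilKN : pi_nilpotent (sigma i) (K / N).
  apply: (@central_Hall_pi_nilpotent _ _ _ (H / N)%G) => //.
  - by rewrite quotient_normal // (normalS sHK (normal_sub nKG)).
  - rewrite index_quotient_eq ?(subset_trans (subsetIr _ _)) //.
  - apply: (@pnat_dvd _ #|G : C|) => //.
    have sCC : (K :&: C) / N \subset 'C_(K / N)(H / N).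
      rewrite subsetI quotientS ?subsetIl //=.
      by rewrite -quotient_astabQ quotientS // /C setIA subsetIr.
    apply: dvdn_trans (indexgS _ sCC) _.
    apply: dvdn_trans (index_quotient _) _.
      exact: subset_trans (subsetIl _ _) nNK.
    by rewrite indexgI index_dvd_normal ?normal_sub.
pose L := (coset N @*^-1 'O_(sigma i)^'(K / N))%G.
have sLK : L \subset K by rewrite sub_cosetpre_quo ?pcore_sub // (normalS sNK (normal_sub nKG)).
exists L; split.
- by rewrite sub_cosetpre.
- by rewrite -(quotientGK nNG) cosetpre_normal gFnormal_trans ?quotient_normal.
- rewrite -card_quotient ?subsetIl // cosetpreK; exact: pcore_pgroup.
rewrite -(Lagrange_index (normal_sub nKG) sLK) pnatM piGK /=.
have sNL : N \subset L by rewrite sub_cosetpre.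
rewrite -(@index_quotient_eq _ K N L) ?(subset_trans (subsetIr K N)) //.
by rewrite cosetpreK.
Qed.

(** Put L = O_{i'}(G). Then L meets H inside K, since otherwise H = K (L ∩ H) and H / K would be a
    sigma_i'-group. Hence [L, H] lies in K, so L centralises H / K, and both H / K and G / C_G(H /
    K) have order dividing |G : L|. *)
Lemma pi_nilpotent_block_nilpotent gT i (G : {group gT}) :
  pi_nilpotent (sigma i) G -> block_nilpotent sigma i G.
Proof.
move=> nilG H K chiefHK iHK.
have [/maxgroupP[/andP[ltKH nKG] maxK] nHG] := andP chiefHK.
have sKH := proper_sub ltKH; have sHG := normal_sub nHG.
pose L := 'O_(sigma i)^'(G)%G; have nLG : L <| G := pcore_normal _ _.
have nKH := subset_trans sHG nKG.
have sLHK : L :&: H \subset K.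
  have nKM : L :&: H \subset 'N(K) := subset_trans (subsetIr _ _) nKH.
  have [] := boolP (K <*> (L :&: H) \proper H) => [ltMH | ].
    suff <- : K <*> (L :&: H) = K by apply: joing_subr.
    apply: (maxK (K <*> (L :&: H))%G); last exact: joing_subl.
    by rewrite ltMH normsY // normsI // normal_norm.
  rewrite properEneq join_subG sKH subsetIr !andbT negbK => /eqP defH.
  have /negP[] : ~~ (sigma i)^'.-nat #|H / K| by apply/sigma_setE.
  rewrite -[in X in _.-nat X]defH quotientYidl //; apply: quotient_pgroup.
  exact: pgroupS (subsetIl _ _) (pcore_pgroup _ _).
exists i; split.
  rewrite /pgroup card_quotient //; apply: pnat_dvd nilG.
  apply: dvdn_trans (index_dvd_normal nLG sHG).
  by rewrite -[X in _ %| X]indexgI indexgS //= setIC.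
rewrite /pgroup card_quotient; last exact: normal_norm (normal_astabQ _ (normal_norm nHG)).
apply: pnat_dvd nilG; apply: indexgS; rewrite subsetI normal_sub //=.
rewrite sub_astabQR ?(subset_trans (normal_sub nLG)) //.
apply: subset_trans sLHK; rewrite commg_subI // subsetI subxx.
  by rewrite (subset_trans (normal_sub nLG)) ?normal_norm.
by rewrite (subset_trans sHG) ?normal_norm.
Qed.

Lemma block_nilpotentP gT i (G : {group gT}) :
  block_nilpotent sigma i G <-> pi_nilpotent (sigma i) G.
Proof.
split; [exact: block_nilpotent_pi_nilpotent | exact: pi_nilpotent_block_nilpotent].
Qed.

Lemma is_block_FittingP gT i (G F : {group gT}) :
  is_block_Fitting sigma i G F <-> F = pi_Fitting_group (sigma i) G.
Proof.
split=> [[nFG /block_nilpotentP nilF maxF] | ->].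
  apply: group_inj; apply/eqP; rewrite eqEsubset pi_Fitting_max //=.
  apply: maxF; first exact: pi_Fitting_normal.
  by apply/block_nilpotentP; apply: pi_Fitting_nilpotent.
split; first exact: pi_Fitting_normal.
  by apply/block_nilpotentP; apply: pi_Fitting_nilpotent.
by move=> N nNG /block_nilpotentP; apply: pi_Fitting_max.
Qed.

(** A chief factor is non-trivial, so a prime divisor of its order selects a block whose nilpotency
    condition applies to it. *)
Lemma sigma_nilpotentP gT (G : {group gT}) :
  sigma_nilpotent sigma G <-> forall i, pi_nilpotent (sigma i) G.
Proof.
split=> [nilG i | nilG H K chiefHK].
  by apply/block_nilpotentP => H K chiefHK _; apply: nilG.
have [/maxgroupp/andP[ltKH nKG] nHG] := andP chiefHK.
have ntHK : H / K != 1.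
  rewrite -subG1 quotient_sub1 ?proper_subn // (subset_trans (normal_sub nHG)) //.
rewrite -cardG_gt1 in ntHK.
have [i pi] := (proj1 sigma_part _).1 (pdiv_prime ntHK).
have /block_nilpotentP nilGi := nilG i; apply: nilGi => //.
by exists (pdiv #|H / K|) => //; rewrite mem_primes pdiv_prime ?cardG_gt0 ?pdiv_dvd.
Qed.

End Partition.

(** * Indices in products of subgroups, and pi-separable groups *)

Lemma index_mul_subgroup (gT : finGroupType) (G A B : {group gT}) :
  A * B = G -> #|G : B| = #|A : A :&: B|.
Proof.
move=> defG; apply/eqP; rewrite -(eqn_pmul2r (cardG_gt0 B)) indexgI.
rewrite (LagrangeMr A) defG mulnC Lagrange //.
by rewrite -defG mulG_subr.
Qed.

(* |N : N :&: B| divides both |N| and |A : A :&: B| = |G : B|. *)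
Lemma normal_Hall_index_sub (gT : finGroupType) (pi : nat_pred)
    (G A B N : {group gT}) :
  A * B = G -> pi^'.-nat #|G : B| -> N <| A -> pi.-group N -> N \subset B.
Proof.
move=> defG pi'GB nNA piN; rewrite -indexg_eq1; apply/eqP.
have sNA := normal_sub nNA.
pose D := (A :&: B)%G; have sDA : D \subset A := subsetIl _ _.
have dvdNB : #|N : B| %| #|A : D|.
  have -> : #|N : B| = #|N : D|.
    by rewrite -(indexgI N B) -(indexgI N D) /= setIA (setIidPl sNA).
  rewrite -(dvdn_pmul2r (cardG_gt0 D)) (mulnC #|A : D|) Lagrange // LagrangeMr.
  rewrite -norm_joinEr ?cardSg ?join_subG ?sNA //.
  by rewrite (subset_trans sDA) ?normal_norm.
have pi'NB : pi^'.-nat #|N : B|.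
  by apply: pnat_dvd dvdNB _; rewrite -(index_mul_subgroup defG).
have piNB : pi.-nat #|N : B| := pnat_dvd (dvdn_indexg _ _) piN.
exact: pnat_1 piNB pi'NB.
Qed.

Lemma mulG_comm (gT : finGroupType) (G A B : {group gT}) : A * B = G -> B * A = G.
Proof.
move=> defG; have /comm_group_setP <- // : group_set (A * B).
by rewrite defG groupP.
Qed.

Lemma pi_Fitting_trivg (gT : finGroupType) (pi : nat_pred) (G : {group gT}) :
  'O_pi^'(G) = 1 -> pi_Fitting pi G = 'O_pi(G).
Proof.
move=> O1; apply/eqP; rewrite eqEsubset; apply/andP; split.
  apply: pcore_max (pi_Fitting_normal _ _).
  rewrite /pgroup -indexg1.
  have: 'O_pi^'(pi_Fitting pi G) \subset 'O_pi^'(G).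
    apply: pcore_max (pcore_pgroup _ _) _.
    exact: char_normal_trans (pcore_char _ _) (pi_Fitting_normal _ _).
  rewrite O1 => /trivgP F1; have := pi_Fitting_nilpotent pi G.
  by rewrite /pi_nilpotent F1.
apply: pi_Fitting_max (pcore_normal _ _) _.
apply: (@pi_nilpotentI _ _ _ 1%G); rewrite ?normal1 ?pgroup1 //.
by rewrite indexg1; apply: pcore_pgroup.
Qed.

(** With this family of two classes, [primary_series] expresses pi-separability. *)
Definition pi_pair (pi : nat_pred) (b : bool) : nat_pred := if b then pi else pi^'.

(** The Hall-Higman centraliser lemma. If C = C_G(P) exceeds Z = C ∩ P, then C / Z has a non-trivial
    core for pi or for pi', with preimage U normal in G. A pi-group U lies in P, hence in Z. If U /
    Z is a pi'-group, Z is a central Hall subgroup of U, and its normal complement lies in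
    O_{pi'}(G) = 1; so U = Z again. *)
Lemma cent_pcore_sub_pcore (pi : nat_pred) (gT : finGroupType) (G : {group gT}) :
  primary_series (pi_pair pi) G -> 'O_pi^'(G) = 1 ->
  'C_G('O_pi(G)) \subset 'O_pi(G).
Proof.
move=> serG O1; set P := 'O_pi(G)%G; pose C := 'C_G(P)%G.
have nPG : P <| G := pcore_normal _ _; have piP : pi.-group P := pcore_pgroup _ _.
have sCG : C \subset G := subsetIl _ _.
have nCG : C <| G by rewrite /normal sCG normsI ?normG ?norms_cent ?normal_norm.
pose Z := (C :&: P)%G; have sZC : Z \subset C := subsetIl _ _.
have nZG : Z <| G by apply: normalI.
have nZC : Z <| C := normalS sZC sCG nZG.
have piZ : pi.-group Z := pgroupS (subsetIr _ _) piP.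
apply/setIidPl; apply/eqP; rewrite -[_ == _]/(Z == C :> {set gT}).
rewrite eqEsubset sZC /= -quotient_sub1 ?normal_norm // subG1.
apply/negPn/negP => ntCZ.
have [] := primary_series_pcore (primary_series_quotient (primary_series_sub serG sCG)
  (normal_norm nZC)) ntCZ.
move=> k /negP[]; set O := 'O_(_)(_).
pose U := (coset Z @*^-1 O)%G.
have nUG : U <| G.
  rewrite -(quotientGK nZG) cosetpre_normal.
  exact: char_normal_trans (pcore_char _ _) (quotient_normal _ nCG).
have sUC : U \subset C by rewrite sub_cosetpre_quo ?pcore_sub.
have sZU : Z \subset U := sub_cosetpre _.
have kUZ : (pi_pair pi k).-nat #|U : Z|.
  by rewrite -card_quotient ?subsetIl // cosetpreK; apply: pcore_pgroup.
suff sUZ : U \subset Z by rewrite -[O]cosetpreK -subG1 quotient_sub1 // subsetIl.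
case: k => /= in O U nUG sUC sZU kUZ *.
  rewrite subsetI sUC pcore_max // /pgroup -(Lagrange sZU) pnatM kUZ andbT.
  exact: piZ.
have: pi_nilpotent pi U.
  apply: (@central_Hall_pi_nilpotent _ _ _ Z) => //.
    exact: normalS sZU (normal_sub nUG) nZG.
  have /setIidPl-> : U \subset 'C(Z).
    apply: subset_trans sUC _; apply: subset_trans (subsetIr _ _) _.
    exact: centS (subsetIr _ _).
  by rewrite indexgg.
have: 'O_pi^'(U) \subset 'O_pi^'(G).
  apply: pcore_max (pcore_pgroup _ _) _.
  exact: char_normal_trans (pcore_char _ _) nUG.
rewrite O1 /pi_nilpotent => /trivgP->; rewrite indexg1 => piU.
by rewrite -indexg_eq1; apply/eqP/(pnat_1 _ kUZ)/(pnat_dvd (dvdn_indexg _ _) piU).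
Qed.

Lemma solvable_primary_series (pi : nat_pred) (gT : finGroupType) (G : {group gT}) :
  solvable G -> primary_series (pi_pair pi) G.
Proof.
have [n] := ubnP #|G|; elim: n => // n IH in gT G *; rewrite ltnS => leGn solG.
have [/group_inj-> | ntG] := eqVneq (G : {set gT}) 1.
  exact: primary_series1.
have [N [sNG nNG ntN /is_abelemP[p _ /abelem_pgroup pN]]] :=
  solvable_norm_abelem solG (normal_refl G) ntG.
apply: (primary_series_ext nNG); last first.
  apply: IH; last exact: quotient_sol.
  by apply: leq_trans leGn; rewrite ltn_quotient.
apply: (@primary_seriesS _ _ _ _ _ (p \in pi)); first exact: primary_series1.
  exact: normal1.
rewrite indexg1; apply: sub_in_pnat pN => r _; rewrite inE => /eqP->.
by rewrite /pi_pair; case: ifPn.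
Qed.

(** * Triple factorisations with sigma-coprime indices *)

Section HawkesFactorization.

Variables (I : Type) (sigma : I -> nat_pred).
Implicit Types gT : finGroupType.

(** The coprimality of the indices is stated block by block, because in this form it passes to the
    quotient by the core M of B in G. *)
Lemma primary_series_factorization gT (G A B C : {group gT}) :
  A * B = G -> B * C = G -> A * C = G ->
  primary_series sigma A -> primary_series sigma B -> primary_series sigma C ->
  (forall i, (sigma i)^'.-nat #|G : B| \/ (sigma i)^'.-nat #|G : C|) ->
  (forall i, (sigma i)^'.-nat #|G : A| \/ (sigma i)^'.-nat #|G : C|) ->
  (forall i, (sigma i)^'.-nat #|G : A| \/ (sigma i)^'.-nat #|G : B|) ->
  primary_series sigma G.
Proof.
have [n] := ubnP #|G|; elim: n => // n IH in gT G A B C *; rewrite ltnS => leGn.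
move=> defAB defBC defAC serA serB serC coBC coAC coAB.
have [A1 | ntA] := eqVneq (A : {set gT}) 1.
  suff -> : G = B by [].
  by apply: group_inj; rewrite -defAB A1 mul1g.
have [i ntN] := primary_series_pcore serA ntA.
wlog pi'B: B C defAB defBC defAC serB serC coBC coAC coAB / (sigma i)^'.-nat #|G : B|.
  move=> IHs; have [pi'B | pi'C] := coBC i; first exact: (IHs B C).
  apply: (IHs C B) => //; first exact: mulG_comm.
  by move=> j; case: (coBC j); auto.
pose M := gcore_group B G; have sMB : M \subset B := gcore_sub _ _.
have [sAG sBG] : A \subset G /\ B \subset G by rewrite -defAB mulG_subl mulG_subr.
have sCG : C \subset G by rewrite -defAC mulG_subr.
have nMG : M <| G by rewrite gcore_normal.
have nM (X : {group gT}) : X \subset G -> X \subset 'N(M).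
  by move=> sXG; rewrite (subset_trans sXG) ?normal_norm.
have sNB : 'O_(sigma i)(A) \subset B.
  exact: normal_Hall_index_sub defAB pi'B (pcore_normal _ _) (pcore_pgroup _ _).
have sNM : 'O_(sigma i)(A) \subset M.
  apply/subsetP => x Nx; rewrite /= /gcore; apply/bigcapP => g.
  (* Since G = B A, every conjugate of B is some B^a with a in A, and a normalises O_i(A). *)
  rewrite -(mulG_comm defAB) => /imset2P[b a Bb Aa ->].
  rewrite conjsgM conjGid // mem_conjg (subsetP sNB) //.
  by rewrite memJ_norm // groupV (subsetP (gFnorm _ _)).
apply: (primary_series_ext nMG (primary_series_sub serB sMB)).
have ntM : M :!=: 1 := subG1_contra sNM ntN.
apply: (IH _ _ (A / M)%G (B / M)%G (C / M)%G).
- by apply: leq_trans leGn; rewrite ltn_quotient ?normal_sub.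
- by rewrite -quotientMl ?defAB ?nM.
- by rewrite -quotientMl ?defBC ?nM.
- by rewrite -quotientMl ?defAC ?nM.
- by apply: primary_series_quotient (nM _ _).
- by apply: primary_series_quotient (nM _ _).
- by apply: primary_series_quotient (nM _ _).
- by move=> j; case: (coBC j) => ?; [left | right]; apply: morphim_p_index (nM _ _) _.
- by move=> j; case: (coAC j) => ?; [left | right]; apply: morphim_p_index (nM _ _) _.
- by move=> j; case: (coAB j) => ?; [left | right]; apply: morphim_p_index (nM _ _) _.
Qed.

Hypothesis sigma_part : prime_partition sigma.

Lemma primary_series_pi_pair gT (G : {group gT}) i :
  primary_series sigma G -> primary_series (pi_pair (sigma i)) G.
Proof.
apply: primary_series_weaken => k; have [-> | ne_ki] := boolp.EM (k = i).
  by exists true.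
by exists false; apply: (block_disjoint sigma_part).
Qed.

Lemma pi_Fitting_index_trivg gT (G A B : {group gT}) i j :
  primary_series sigma G -> 'O_(sigma i)^'(G) = 1 -> A * B = G ->
  (sigma i)^'.-nat #|G : A| -> (sigma i)^'.-nat #|G : B| ->
  (sigma j)^'.-nat #|A : pi_Fitting (sigma i) A| ->
  (sigma j)^'.-nat #|B : pi_Fitting (sigma i) B| ->
  (sigma j)^'.-nat #|G : 'O_(sigma i)(G)|.
Proof.
move=> serG O1 defG pi'A pi'B jA jB; have defG' := mulG_comm defG.
have [sAG sBG] : A \subset G /\ B \subset G.
  by rewrite -defG mulG_subl mulG_subr.
(* Since X contains P = O_i(G), its subgroups O_{i'}(X) and P normalise each other and meet
   trivially. So O_{i'}(X) lies in C_G(P), hence in P, and is trivial. *)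
have core1 (X : {group gT}) : X \subset G -> (sigma i)^'.-nat #|G : X| ->
    'O_(sigma i)^'(X) = 1.
  move=> sXG pi'X; set P := 'O_(sigma i)(G)%G; set L := 'O_(sigma i)^'(X)%G.
  have sPX : P \subset X.
    by apply: (normal_Hall_index_sub _ pi'X) (pcore_normal _ _) (pcore_pgroup _ _);
       rewrite mulGSid.
  have sLX : L \subset X := pcore_sub _ _.
  have pi'L : (sigma i)^'.-group L := pcore_pgroup _ _.
  have tiPL : P :&: L = 1 := coprime_TIg (pnat_coprime (pcore_pgroup _ _) pi'L).
  apply/trivgP; rewrite -tiPL subsetI subxx andbT.
  apply: subset_trans (cent_pcore_sub_pcore (primary_series_pi_pair i serG) O1); rewrite subsetI.
  rewrite (subset_trans sLX sXG) /=; apply/commG1P/trivgP; rewrite -tiPL /= commGC.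
  rewrite commg_subI // subsetI subxx.
    by rewrite (subset_trans sPX) ?gFnorm.
  by rewrite (subset_trans sLX) // (subset_trans sXG) ?gFnorm.
rewrite !pi_Fitting_trivg ?core1 // in jA jB.
(* For i <> j the core O_i(X) is itself a sigma_j'-group, so A, B and then G = A B are
   sigma_j'-groups. *)
have [ij | ne_ij] := boolp.EM (i = j); last first.
  have j'X (X : {group gT}) : (sigma j)^'.-nat #|X : 'O_(sigma i)(X)| ->
      (sigma j)^'.-group X.
    move=> jX; rewrite /pgroup -(Lagrange (pcore_sub (sigma i) X)) pnatM jX andbT.
    exact: sub_in_pnat (fun p _ => block_disjoint sigma_part ne_ij (x := p))
      (pcore_pgroup _ _).
  apply: pnat_dvd (dvdn_indexg _ _) _.
  by rewrite -[_.-nat _]/(_.-group G) -defG pgroupM !j'X.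
rewrite -{}ij in jA jB *.
(* For i = j the core O_i(Y) is a normal Hall subgroup of Y and absorbs the sigma_i-group O_i(X). By
   symmetry the two cores agree, so A B = G normalises them. *)
have sub_core (X Y : {group gT}) : X * Y = G -> (sigma i)^'.-nat #|G : Y| ->
    (sigma i)^'.-nat #|Y : 'O_(sigma i)(Y)| ->
    'O_(sigma i)(X) \subset 'O_(sigma i)(Y).
  move=> defXY pi'Y iY; rewrite sub_Hall_pcore ?pcore_pgroup //.
    by rewrite /pHall pcore_sub pcore_pgroup.
  exact: normal_Hall_index_sub defXY pi'Y (pcore_normal _ _) (pcore_pgroup _ _).
have eqAB : 'O_(sigma i)(A) = 'O_(sigma i)(B).
  by apply/eqP; rewrite eqEsubset !sub_core.
have sAO : 'O_(sigma i)(A) \subset 'O_(sigma i)(G).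
  apply: pcore_max (pcore_pgroup _ _) _.
  rewrite /normal (subset_trans (pcore_sub _ _)) //= -defG mulG_subG gFnorm.
  by rewrite eqAB gFnorm.
apply: pnat_dvd (indexgS G sAO) _.
by rewrite -(Lagrange_index sAG (pcore_sub _ _)) pnatM pi'A.
Qed.

Lemma index_pi_Fitting_mod gT (pi : nat_pred) (G : {group gT}) :
  #|G : pi_Fitting pi G| = #|G / 'O_pi^'(G) : 'O_pi(G / 'O_pi^'(G))|.
Proof.
rewrite -quotient_pi_Fitting index_quotient_eq ?gFnorm //.
  by rewrite (subset_trans (subsetIr _ _)) ?pcore_sub_pi_Fitting.
exact: normal_sub (pi_Fitting_normal _ _).
Qed.

Lemma pi_Fitting_index_quotient gT (pi rho : nat_pred) (A M : {group gT}) :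
  A \subset 'N(M) -> rho.-nat #|A : pi_Fitting pi A| ->
  rho.-nat #|A / M : pi_Fitting pi (A / M)|.
Proof.
move=> nMA rhoA; have sFA := normal_sub (pi_Fitting_normal pi A).
have sF : pi_Fitting pi A / M \subset pi_Fitting pi (A / M).
  apply: pi_Fitting_max; first exact: quotient_normal (pi_Fitting_normal _ _).
  by apply: pi_nilpotent_quotient (pi_Fitting_nilpotent _ _); apply: subset_trans nMA.
apply: pnat_dvd (indexgS _ sF) _.
exact: morphim_p_index (subset_trans sFA nMA) rhoA.
Qed.

Lemma pi_Fitting_index_factorization gT (G A B : {group gT}) i j :
  primary_series sigma G -> A * B = G ->
  (sigma i)^'.-nat #|G : A| -> (sigma i)^'.-nat #|G : B| ->
  (sigma j)^'.-nat #|A : pi_Fitting (sigma i) A| ->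
  (sigma j)^'.-nat #|B : pi_Fitting (sigma i) B| ->
  (sigma j)^'.-nat #|G : pi_Fitting (sigma i) G|.
Proof.
move=> serG defG pi'A pi'B jA jB; rewrite index_pi_Fitting_mod.
pose M := 'O_(sigma i)^'(G)%G; have nMG : G \subset 'N(M) by apply: gFnorm.
have nMA : A \subset 'N(M) by apply: subset_trans nMG; rewrite -defG mulG_subl.
have nMB : B \subset 'N(M) by apply: subset_trans nMG; rewrite -defG mulG_subr.
apply: (@pi_Fitting_index_trivg _ _ (A / M)%G (B / M)%G).
- exact: primary_series_quotient.
- exact: trivg_pcore_quotient.
- by rewrite -quotientMl ?defG.
- exact: morphim_p_index.
- exact: morphim_p_index.
- exact: pi_Fitting_index_quotient.
- exact: pi_Fitting_index_quotient.
Qed.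

(** The intersection of A with O_{pi',pi}(G) is normal and pi-nilpotent in A. This makes the edges
    of the sigma-Hawkes graph monotone in the group. *)
Lemma pi_Fitting_index_sub gT (G A : {group gT}) (pi rho : nat_pred) :
  A \subset G -> rho.-nat #|G : pi_Fitting pi G| ->
  rho.-nat #|A : pi_Fitting pi A|.
Proof.
move=> sAG; apply: pnat_dvd.
apply: dvdn_trans (index_dvd_normal (pi_Fitting_normal pi G) sAG).
rewrite -[X in _ %| X]indexgI indexgS // pi_Fitting_max //.
  exact: normalGI sAG (pi_Fitting_normal _ _).
by apply: pi_nilpotent_sub (pi_Fitting_nilpotent _ _) _; apply: subsetIr.
Qed.

(** The two vertex conditions are recovered from the index: a sigma_i'-group G equals its own
    O_{i',i}(G), and the index divides |G|. *)
Lemma edges_Hawkes_graph gT (G : {group gT}) i j :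
  edges (Hawkes_graph sigma G) (i, j) <->
  ~~ (sigma j)^'.-nat #|G : pi_Fitting (sigma i) G|.
Proof.
have nFG := normal_norm (pi_Fitting_normal (sigma i) G).
split=> [[_ _ [F /(is_block_FittingP sigma_part)->]] | jG] /=.
  by move/(sigma_setE _ _ (cardG_gt0 _)); rewrite card_quotient.
split=> /=; last first.
- exists (pi_Fitting_group (sigma i) G); first exact/is_block_FittingP.
  by apply/sigma_setE; rewrite ?cardG_gt0 //= card_quotient.
- apply/sigma_setE => //; apply: contra jG; exact: pnat_dvd (dvdn_indexg _ _).
apply/sigma_setE => //; apply: contra jG => i'G.
have /eqP-> : pi_Fitting (sigma i) G == G; last by rewrite indexgg.
by rewrite pi_Fitting_id; apply: (pi_nilpotentI (normal_refl G)); rewrite ?indexgg.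
Qed.

End HawkesFactorization.

(** * Equality of digraphs and the union formula for sigma-Hawkes graphs *)

Lemma digraph_ext (V : Type) (g h : digraph V) :
  (forall x, vertices g x <-> vertices h x) ->
  (forall x y, edges g (x, y) <-> edges h (x, y)) -> g = h.
Proof.
case: g h => Vg Eg [Vh Eh] /= eqV eqE; congr Digraph.
  by apply: boolp.funext => x; apply/boolp.propext.
by apply: boolp.funext => -[x y]; apply/boolp.propext.
Qed.

Section Factorization.

Variables (I : Type) (sigma : I -> nat_pred).
Implicit Types gT : finGroupType.

Lemma sigma_set_group gT (A : {group gT}) i :
  sigma_set sigma #|A| i <-> ~~ (sigma i)^'.-group A.
Proof. exact: sigma_setE (cardG_gt0 A). Qed.

Lemma sigma_set_factorization gT (G A B : {group gT}) i :
  A * B = G ->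
  sigma_set sigma #|G| i <-> sigma_set sigma #|A| i \/ sigma_set sigma #|B| i.
Proof.
move=> defG; rewrite !sigma_set_group -defG pgroupM negb_and.
by split=> [/orP | ? ]; last apply/orP.
Qed.

Lemma vertices_trifactorization gT (G A B C : {group gT}) i :
  A * B = G -> A * C = G ->
  (sigma_set sigma #|A| i \/ sigma_set sigma #|B| i) \/ sigma_set sigma #|C| i <->
  sigma_set sigma #|G| i.
Proof.
move=> defAB defAC; split=> [[/(sigma_set_factorization i defAB)// | Ci] | ].
  by apply/(sigma_set_factorization i defAC); right.
by move/(sigma_set_factorization i defAB); left.
Qed.

Lemma sigma_coprime_index gT (G A B : {group gT}) :
  sigma_coprime sigma #|G : A| #|G : B| ->
  forall i, (sigma i)^'.-nat #|G : A| \/ (sigma i)^'.-nat #|G : B|.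
Proof.
move=> coAB i; apply/orP; rewrite -[_ || _]negbK negb_or.
apply/negP => /andP[/sigma_setE Ai /sigma_setE Bi].
have: classical_sets.setI (sigma_set sigma #|G : A|) (sigma_set sigma #|G : B|) i.
  by split; [apply: Ai | apply: Bi].
by rewrite coAB.
Qed.

Hypothesis sigma_part : prime_partition sigma.

Lemma Hawkes_graph_factorization gT (G A B C : {group gT}) :
  A * B = G -> B * C = G -> A * C = G ->
  sigma_soluble sigma A -> sigma_soluble sigma B -> sigma_soluble sigma C ->
  sigma_coprime sigma #|G : A| #|G : B| ->
  sigma_coprime sigma #|G : B| #|G : C| ->
  sigma_coprime sigma #|G : A| #|G : C| ->
  digraph_union (digraph_union (Hawkes_graph sigma A) (Hawkes_graph sigma B))
    (Hawkes_graph sigma C) = Hawkes_graph sigma G.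
Proof.
move=> defAB defBC defAC /sigma_soluble_primary_series serA.
move=> /sigma_soluble_primary_series serB /sigma_soluble_primary_series serC.
move=> /sigma_coprime_index coAB /sigma_coprime_index coBC /sigma_coprime_index coAC.
have serG := primary_series_factorization defAB defBC defAC serA serB serC coBC coAC coAB.
have [sAG sBG] : A \subset G /\ B \subset G by rewrite -defAB mulG_subl mulG_subr.
have sCG : C \subset G by rewrite -defAC mulG_subr.
apply: digraph_ext => [i | i j]; first exact: vertices_trifactorization.
split=> [ | /(edges_Hawkes_graph sigma_part) jG].
  by case=> [[|]|] /(edges_Hawkes_graph sigma_part) jX;
     apply/(edges_Hawkes_graph sigma_part); apply: contra jX; apply: pi_Fitting_index_sub.
apply: boolp.contrapT => noE.
have noedge (X : {group gT}) : ~ edges (Hawkes_graph sigma X) (i, j) ->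
    (sigma j)^'.-nat #|X : pi_Fitting (sigma i) X|.
  by move=> noX; apply/idPn => jX; apply: noX; apply/edges_Hawkes_graph.
have jA : (sigma j)^'.-nat #|A : pi_Fitting (sigma i) A|.
  by apply: noedge => E; apply: noE; left; left.
have jB : (sigma j)^'.-nat #|B : pi_Fitting (sigma i) B|.
  by apply: noedge => E; apply: noE; left; right.
have jC : (sigma j)^'.-nat #|C : pi_Fitting (sigma i) C|.
  by apply: noedge => E; apply: noE; right.
move: jG; apply/negP; rewrite negbK.
(* Two of the three indices are sigma_i'-numbers; the cases select the product of the corresponding
   two factors. *)
have [iA | iB] := coAB i.
  have [iB | iC] := coBC i; first exact: (pi_Fitting_index_factorization _ serG defAB).
  exact: (pi_Fitting_index_factorization _ serG defAC).
have [iA | iC] := coAC i; first exact: (pi_Fitting_index_factorization _ serG defAB).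
exact: (pi_Fitting_index_factorization _ serG defBC).
Qed.

End Factorization.

(** * Hall {p,q}-subgroups of an extension of a q'-group by a {p,q}-group *)

Definition pair_pred (p q : nat) : nat_pred := [pred r | (r == p) || (r == q)].

Lemma pair_predC p q : pair_pred p q =i pair_pred q p.
Proof. by move=> r; rewrite !inE orbC. Qed.

Section PairHall.

Variables p q : nat.
Local Notation pq := (pair_pred p q).
Implicit Types gT : finGroupType.

Lemma pair_group_solvable gT (S : {group gT}) : pq.-group S -> solvable S.
Proof.
move=> pqS; apply: integral_char.Burnside_p_a_q_b.
rewrite -[2]/(size [:: p; q]) uniq_leq_size ?primes_uniq // => r rS.
by have := pnatPpi pqS rS; rewrite !inE.
Qed.

Lemma pair_nat_p n : pq.-nat n -> q^'.-nat n -> p.-nat n.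
Proof.
move=> /andP[n_gt0 /allP pqn] /andP[_ /allP q'n].
rewrite /pnat n_gt0 /=; apply/allP => r rn.
by move: (pqn r rn) (q'n r rn); rewrite !inE => /orP[//|->].
Qed.

Lemma pair_nat_p' n : p^'.-nat n -> q^'.-nat n -> pq^'.-nat n.
Proof.
move=> /andP[n_gt0 /allP p'n] /andP[_ /allP q'n].
rewrite /pnat n_gt0 /=; apply/allP => r rn.
by move: (p'n r rn) (q'n r rn); rewrite !inE negb_or => -> ->.
Qed.

Lemma pair_group_p gT (S : {group gT}) : p.-group S -> pq.-group S.
Proof. by apply: sub_in_pnat => r _; rewrite !inE => ->. Qed.

Lemma pair_group_q gT (S : {group gT}) : q.-group S -> pq.-group S.
Proof. by apply: sub_in_pnat => r _; rewrite !inE => ->; rewrite orbT. Qed.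

Lemma pair_Hall_Sylow gT (N X : {group gT}) :
  q^'.-group N -> pq.-Hall(N) X = p.-Sylow(N) X.
Proof.
move=> q'N; apply/and3P/and3P => [[sXN pqX pq'X] | [sXN pX p'X]]; split=> //.
- exact: pair_nat_p pqX (pgroupS sXN q'N).
- by apply: sub_in_pnat pq'X => r _; rewrite !inE negb_or => /andP[].
- exact: pair_group_p.
- exact: pair_nat_p' p'X (pnat_dvd (dvdn_indexg _ _) q'N).
Qed.

Lemma pHall_setI_normal gT (pi : nat_pred) (E N H : {group gT}) :
  N <| E -> pi.-Hall(E) H -> pi.-Hall(N) (N :&: H).
Proof.
move=> nNE /and3P[sHE piH pi'H]; have sNE := normal_sub nNE.
rewrite /pHall subsetIl (pgroupS (subsetIr _ _) piH) /= indexgI.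
apply: pnat_dvd pi'H; rewrite -(dvdn_pmul2r (cardG_gt0 H)) LagrangeMr.
rewrite (mulnC #|E : H|) Lagrange // -norm_joinEr ?cardSg ?join_subG ?sNE //.
by rewrite (subset_trans sHE) ?normal_norm.
Qed.

Lemma pHall_mul gT (pi : nat_pred) (E N H : {group gT}) :
  N * H = E -> pi.-group H -> pi.-Hall(N) (N :&: H) -> pi.-Hall(E) H.
Proof.
move=> defE piH /and3P[_ _ pi'N]; rewrite /pHall piH -defE mulG_subr /=.
by rewrite defE (index_mul_subgroup defE).
Qed.

Lemma pHall_mul_normal gT (pi : nat_pred) (E N H : {group gT}) :
  N <| E -> pi.-group (E / N) -> pi.-Hall(E) H -> N * H = E.
Proof.
move=> nNE piEN /and3P[sHE piH pi'H].
have nHN : H \subset 'N(N) := subset_trans sHE (normal_norm nNE).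
have sNE := normal_sub nNE.
apply/eqP; rewrite -norm_joinEr // eqEsubset join_subG sNE sHE /=.
rewrite -indexg_eq1; apply/eqP/(@pnat_1 pi).
  apply: pnat_dvd piEN; rewrite card_quotient ?normal_norm //.
  exact: indexgS (joing_subl _ _).
exact: pnat_dvd (indexgS _ (joing_subr _ _)) pi'H.
Qed.

(** Let P be a Sylow p-subgroup of N and M = N_E(P), so that E = N M by Frattini. In M / P the
    normal Hall subgroup N_N(P) / P has a complement by Schur-Zassenhaus; its preimage H covers E /
    N and meets N in P. *)
Lemma pair_Hall_exists_normal gT (E N : {group gT}) :
  N <| E -> q^'.-group N -> pq.-group (E / N) -> exists H : {group gT}, pq.-Hall(E) H.
Proof.
move=> nNE q'N pqEN; have [sNE nNE'] := andP nNE.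
have [P sylP] := Sylow_exists p N; have [sPN pP p'P] := and3P sylP.
pose M := 'N_E(P)%G; pose K := 'N_N(P)%G.
have defE : N * M = E := Frattini_arg nNE sylP.
have nKM : K <| M.
  by have := normalGI (subsetIl E 'N(P)) nNE; rewrite setIAC (setIidPr sNE).
have nPM : P <| M by rewrite /normal subsetI (subset_trans sPN) ?normG ?subsetIr.
have nPK : P <| K by rewrite /normal subsetI sPN normG subsetIr.
have sylPK : p.-Sylow(K) P by rewrite Sylow_subnorm.
have hallPK : pq.-Hall(K) P.
  by rewrite pair_Hall_Sylow // (pgroupS (subsetIl _ _) q'N).
have pq'KP : pq^'.-group (K / P).
  by rewrite /pgroup card_quotient ?normal_norm //; case/and3P: hallPK.
have pqMK : pq.-nat #|M : K|.
  have <- : M :&: N = K by rewrite /= setIAC (setIidPr sNE).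
  by rewrite -(index_mul_subgroup (mulG_comm defE)) -card_quotient.
have sMP : M :&: P \subset K by apply: subset_trans (subsetIr _ _) (normal_sub nPK).
rewrite -(index_quotient_eq sMP (normal_sub nKM) (normal_norm nPM)) in pqMK.
have hallKP : Hall (M / P) (K / P).
  by rewrite /Hall quotientS ?normal_sub //= coprime_sym (pnat_coprime pqMK).
have [Hb] := splitsP (SchurZassenhaus_split hallKP (quotient_normal _ nKM)).
case/complP=> tiKH defMP.
have pqHb : pq.-group Hb.
  by move: pqMK; rewrite -divgS ?quotientS ?normal_sub // -defMP TI_cardMg // mulKn.
have sHbM : Hb \subset M / P by rewrite -defMP mulG_subr.
pose H := (coset P @*^-1 Hb)%G.
have sHM : H \subset M by rewrite sub_cosetpre_quo.
have sPH : P \subset H := sub_cosetpre _.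
have pqH : pq.-group H.
  rewrite /pgroup -(Lagrange sPH) pnatM -card_quotient ?subsetIl // cosetpreK.
  by rewrite [pq.-nat #|P|](pair_group_p pP).
have defKH : K * H = M.
  rewrite -(quotientGK nPK) /= -cosetpreM.
  by rewrite -[RHS](quotientGK nPM) -defMP.
exists H; apply: (pHall_mul (N := N)) => //.
  rewrite -defE -defKH mulgA; congr (_ * _).
  by rewrite mulGSid ?subsetIl.
rewrite pair_Hall_Sylow //= (_ : N :&: H = P) //.
have tiKHP : K :&: H = P.
  apply/eqP; rewrite eqEsubset; apply/andP; split; last by rewrite subsetI sPH andbT normal_sub.
  have nKHP : K :&: H \subset 'N(P) by apply: subset_trans (subsetIl _ _) (normal_norm nPK).
  rewrite -quotient_sub1 // -tiKH subsetI quotientS ?subsetIl //=.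
  by apply: subset_trans (quotientS _ (subsetIr _ _)) _; rewrite cosetpreK.
have nHP : H \subset 'N(P) := subset_trans sHM (normal_norm nPM).
by rewrite -[RHS]tiKHP /= -[RHS]setIA [in RHS](setIidPr nHP).
Qed.

(* Two Hall {p,q}-subgroups meeting N in the same P are complements to the
   pq'-group N_N(P) / P in N_E(P) / P. *)
Lemma pair_Hall_conj_normal gT (E N H1 H2 : {group gT}) :
  N <| E -> q^'.-group N -> pq.-group (E / N) ->
  pq.-Hall(E) H1 -> pq.-Hall(E) H2 -> exists2 x, x \in E & H2 :=: H1 :^ x.
Proof.
move=> nNE q'N pqEN hallH1 hallH2; have [sNE nNE'] := andP nNE.
have conj_eq (X Y : {group gT}) : pq.-Hall(E) X -> pq.-Hall(E) Y ->
    N :&: X = N :&: Y -> exists2 x, x \in E & Y :=: X :^ x.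
  move=> hallX hallY eqXY; pose P := (N :&: X)%G.
  have [sXE sYE] := (pHall_sub hallX, pHall_sub hallY).
  have nPX : P <| X by rewrite /= setIC; apply: normalGI sXE nNE.
  have nPY : P <| Y by rewrite /= eqXY setIC; apply: normalGI sYE nNE.
  pose M := 'N_E(P)%G; pose K := (M :&: N)%G.
  have [sXM sYM] : X \subset M /\ Y \subset M by rewrite !subsetI sXE sYE !normal_norm.
  have hallP : pq.-Hall(N) P := pHall_setI_normal nNE hallX.
  have nPM : M \subset 'N(P) := subsetIr _ _.
  have sKN : K \subset N := subsetIr _ _.
  have sKM : K \subset M := subsetIl _ _.
  have sPK : P \subset K.
    by rewrite !subsetI subsetIl (subset_trans _ sXE) ?subsetIr // normG.
  have nKM : K <| M := normalGI (subsetIl _ _) nNE.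
  have defM : K * X = M.
    by rewrite group_modr // (pHall_mul_normal nNE pqEN hallX) /= setIAC setIid.
  have pq'KP : pq^'.-group (K / P).
    rewrite /pgroup card_quotient ?(subset_trans sKM) //.
    by case/and3P: (pHall_subl sPK sKN hallP).
  have pqX : pq.-group X := pHall_pgroup hallX.
  have [|||||xb Kxb defYP] :=
      @SchurZassenhaus_trans_actsol _ (K / P)%G (X / P)%G (Y / P)%G.
  - exact: quotient_sol (pair_group_solvable pqX).
  - by rewrite quotient_norms // (subset_trans sXM) ?normal_norm.
  - rewrite /= -quotientY ?(subset_trans sXM) ?(subset_trans sKM) //.
    rewrite joingC norm_joinEr ?defM ?quotientS // (subset_trans sXM) //.
    exact: normal_norm.
  - by rewrite coprime_sym (pnat_coprime (quotient_pgroup _ pqX) pq'KP).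
  - rewrite !card_quotient ?normal_norm // -!divgS ?normal_sub //.
    by rewrite (card_Hall hallX) (card_Hall hallY).
  have [x nPx Kx defx] := morphimP Kxb.
  exists x; first exact: subsetP (subsetIl _ _) x (subsetP sKM x Kx).
  apply: (quotient_inj nPY).
    by rewrite -(normP nPx) normalJ.
  by rewrite quotientJ // -defx.
have sylH (H : {group gT}) : pq.-Hall(E) H -> p.-Sylow(N) (N :&: H)%G.
  by move=> hallH; rewrite -pair_Hall_Sylow //; apply: pHall_setI_normal nNE hallH.
(* Both intersections with N are Sylow p-subgroups of N, so conjugation inside N makes them
   equal. *)
have [y Ny defP] := Sylow_trans (sylH _ hallH1) (sylH _ hallH2).
have Ey := subsetP sNE y Ny.
have [|//||x Ex defH2] := conj_eq (H1 :^ y)%G H2; first by rewrite pHallJ.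
  by rewrite [RHS]defP conjIg conjGid.
by exists (y * x); rewrite ?groupM // conjsgM.
Qed.
(** Induction on |E| through normalisers of non-trivial normal subgroups R of S. Either S meets N,
    and R = S ∩ N serves, or R is taken minimal normal in S and the two possible primes of R are
    treated apart. *)
Lemma max_pair_group_Hall gT (E N S : {group gT}) :
  N <| E -> q^'.-group N -> N * S = E -> [max S | pq.-subgroup(E) S] ->
  pq.-Hall(E) S.
Proof.
have [n] := ubnP #|E|; elim: n => // n IH in gT E N S *; rewrite ltnS => leEn.
move=> nNE q'N defE maxS; have [sNE nNE'] := andP nNE.
have [/andP[sSE pqS] maxS'] := maxgroupP maxS.
have pqEN : pq.-group (E / N).
  by rewrite -defE quotientMidl quotient_pgroup.
(* In N_E(R) / R, a group of smaller order, S / R is still maximal: a larger {p,q}-subgroup would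
   pull back to one containing S. *)
have hallR (R : {group gT}) : R <| S -> R :!=: 1 -> pq.-Hall('N_E(R)) S.
  move=> nRS ntR; pose M := 'N_E(R)%G; pose K := (M :&: N)%G.
  have sSM : S \subset M by rewrite subsetI sSE normal_norm.
  have nRM : R <| M.
    by rewrite /normal subsetIr (subset_trans (normal_sub nRS)).
  have nKM : K <| M := normalGI (subsetIl _ _) nNE.
  have pqR : pq.-group R := pgroupS (normal_sub nRS) pqS.
  have defM : K * S = M by rewrite group_modr // defE /= setIAC setIid.
  rewrite -[pq.-Hall(_) _]/(pq.-Hall(M) S) -(pquotient_pHall pqR nRM nRS).
  apply: (IH _ (M / R)%G (K / R)%G (S / R)%G).
  - apply: leq_trans leEn; apply: leq_trans (subset_leq_card (subsetIl E 'N(R))).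
    by rewrite ltn_quotient ?normal_sub.
  - exact: quotient_normal.
  - exact: quotient_pgroup (pgroupS (subsetIr _ _) q'N).
  - by rewrite -quotientMl ?defM // (subset_trans (normal_sub nKM)) ?normal_norm.
  apply/maxgroupP; split=> [|Tb /andP[sTM pqT] sST].
    by rewrite /psubgroup quotientS ?quotient_pgroup.
  pose T := (coset R @*^-1 Tb)%G.
  have sTM' : T \subset M by rewrite sub_cosetpre_quo.
  have defT : T :=: S.
    apply: maxS'; last by rewrite -(quotientGK nRS) morphpreS.
    rewrite /psubgroup (subset_trans sTM') ?subsetIl //.
    rewrite /pgroup -(Lagrange (sub_cosetpre Tb)) pnatM [pq.-nat #|R|]pqR.
    by rewrite -card_quotient ?subsetIl // cosetpreK.
  by rewrite -(cosetpreK Tb) -[_ @*^-1 _]/(gval T) defT.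
have [H hallH] := pair_Hall_exists_normal nNE q'N pqEN.
have [sHE pqH _] := and3P hallH.
have [S1 | ntS] := eqVneq (S : {set gT}) 1.
  by rewrite -(group_inj (maxS' H _ _)) // ?S1 ?sub1G // /psubgroup sHE.
pose T := (S :&: N)%G.
have nTS : T <| S := normalGI sSE nNE.
(* If T = S ∩ N is non-trivial, it is a Sylow p-subgroup of N_N(T), because S is Hall in N_E(T).
   Hence T is Sylow in N, and S is Hall in E = N S. *)
have [T1 | ntT] := eqVneq (T : {set gT}) 1; last first.
  apply: (pHall_mul defE pqS); rewrite pair_Hall_Sylow //= setIC.
  rewrite -[_ :&: _]/(gval T) -Sylow_subnorm -pair_Hall_Sylow; last first.
    exact: pgroupS (subsetIl _ _) q'N.
  have defT : 'N_N(T) :&: S = T.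
    by rewrite setIAC -[N :&: S]setIC (setIidPl _) // normG.
  have nK : 'N_N(T) <| 'N_E(T).
    by have := normalGI (subsetIl E 'N(T)) nNE; rewrite setIAC (setIidPr sNE).
  by have /= := pHall_setI_normal nK (hallR T nTS ntT); rewrite defT.
have [R [sRS nRS ntR abR]] :=
  solvable_norm_abelem (pair_group_solvable pqS) (normal_refl S) ntS.
pose M := 'N_E(R)%G; pose C := (M :&: N)%G.
have sSM : S \subset M by rewrite subsetI sSE normal_norm.
have nCM : C <| M := normalGI (subsetIl _ _) nNE.
have defM : C * S = M by rewrite group_modr // defE /= setIAC setIid.
have sCN : C \subset N := subsetIr _ _.
have tiCS : C :&: S = 1 by apply/trivgP; rewrite -T1 subsetI subsetIr (subset_trans (subsetIl _ _)).
have p'C : p^'.-group C.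
  have := pHall_setI_normal nCM (hallR R nRS ntR).
  rewrite pair_Hall_Sylow ?(pgroupS sCN q'N) // => /and3P[_ _].
  by rewrite /= tiCS indexg1.
have pq'C : pq^'.-group C := pair_nat_p' p'C (pgroupS sCN q'N).
(* C = N_N(R) and R commute because [C, R] lies in N ∩ R = 1. *)
have cCR : C \subset 'C(R).
  have tiRN : R :&: N = 1 by apply/trivgP; rewrite -T1 setSI.
  apply/commG1P/trivgP; rewrite -tiRN /= commGC commg_subI // subsetI.
    by rewrite subxx (subset_trans (subset_trans sRS sSE)).
  by rewrite subsetIr -setIA setICA subsetIl.
have tiNS : N :&: S = 1 by rewrite setIC.
have [r _ /abelem_pgroup rR] := is_abelemP abR.
have /orP[/eqP rp | /eqP rq] : r \in pq.
- have [r_pr rR' _] := pgroup_pdiv rR ntR.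
  by rewrite (pnatPpi (pgroupS sRS pqS)) // mem_primes r_pr cardG_gt0.
(* R is a p-group: if a Sylow p-subgroup Q of R N containing R met N, then N ∩ Q would meet Z(Q).
   That intersection centralises R, so it is a p-subgroup of the p'-group C. Thus N is a p'-group
   and S, a complement of N, is Hall. *)
- rewrite {r}rp in rR; pose J := (R <*> N)%G.
  have nNJ : N <| J.
    rewrite /normal joing_subr join_subG normG andbT.
    exact: subset_trans (subset_trans sRS sSE) nNE'.
  have [Q sylQ sRQ] := Sylow_superset (joing_subl R N) rR.
  have /and3P[_ _ p'NQ] := Sylow_setI_normal nNJ sylQ.
  suff NQ1 : N :&: Q = 1.
    rewrite NQ1 indexg1 in p'NQ; apply: (pHall_mul defE pqS).
    rewrite /pHall /= tiNS sub1G pgroup1 indexg1 /=.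
    exact: pair_nat_p' p'NQ q'N.
  apply/eqP/negPn/negP => ntNQ; case/negP: (ntNQ).
  have nNQ : N :&: Q <| Q by rewrite setIC (normalGI (pHall_sub sylQ) nNJ).
  case/negP: (meet_center_nil (pgroup_nil (pHall_pgroup sylQ)) nNQ ntNQ).
  have sZN : N :&: Q :&: 'Z(Q) \subset N by rewrite -setIA subsetIl.
  have sZR : N :&: Q :&: 'Z(Q) \subset 'N(R).
    rewrite cents_norm // (subset_trans (subsetIr _ _)) //.
    by rewrite (subset_trans (subsetIr _ _)) ?centS.
  have sZC : N :&: Q :&: 'Z(Q) \subset C by rewrite !subsetI (subset_trans sZN) // sZR.
  have pZ : p.-group (N :&: Q :&: 'Z(Q)).
    apply: pgroupS (pHall_pgroup sylQ); apply: subset_trans (subsetIr _ _) _.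
    exact: center_sub.
  by rewrite (card1_trivg (pnat_1 pZ (pgroupS sZC p'C))).
rewrite {r}rq in rR.
(* R is a q-group, and a Hall {p,q}-subgroup contains a Sylow q-subgroup of E, so some conjugate of
   H contains R. *)
wlog sRH : H hallH sHE pqH / R \subset H.
  have q_pq : q \in pq by rewrite !inE eqxx orbT.
  have [x Ex sRHx] := Hall_psubJ hallH q_pq (subset_trans sRS sSE) rR.
  move/(_ (H :^ x)%G); rewrite pHallJ // pgroupJ; apply=> //.
  by rewrite -(conjGid Ex) conjSg.
pose P := (N :&: H)%G; pose L := (R <*> N :&: H)%G.
have nRN : R \subset 'N(N) := subset_trans (subset_trans sRS sSE) nNE'.
have nRNE : R <*> N <| E.
  rewrite /normal join_subG sNE (subset_trans sRS) //= -defE mulG_subG.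
  apply/andP; split; first exact: subset_trans (joing_subr R N) (normG _).
  exact: normsY (normal_norm nRS) (subset_trans sSE nNE').
have nLH : L <| H by rewrite /= setIC; apply: normalGI sHE nRNE.
have defL : P * R = L.
  by rewrite /= [N :&: H]setIC group_modr // [RHS]setIC -norm_joinEr // joingC.
have sylR : q.-Sylow(L) R.
  rewrite /pHall -{1}defL mulG_subr rR /= (index_mul_subgroup defL).
  exact: pnat_dvd (dvdn_indexg _ _) (pgroupS (subsetIl _ _) q'N).
(* R is Sylow in L = (N ∩ H) R, which is normal in H, so Frattini gives H = (N ∩ H) Y. As N ∩ Y is
   trivial, Y has the order of E / N, which is that of S. *)
pose Y := 'N_H(R)%G.
have defH : P * Y = H.
  rewrite -(Frattini_arg nLH sylR) -defL -mulgA; congr (_ * _).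
  by rewrite mulSGid // subsetI sRH normG.
have tiPY : P :&: Y = 1.
  have sC : P :&: Y \subset C.
    apply/subsetP => z /setIP[/setIP[Nz _] /setIP[_ Rz]].
    by rewrite 2!in_setI Nz Rz (subsetP sNE).
  have pqPY : pq.-group (P :&: Y).
    by apply: pgroupS pqH; apply: subset_trans (subsetIl _ _) (subsetIr _ _).
  by rewrite (card1_trivg (pnat_1 pqPY (pgroupS sC pq'C))).
have cardS : #|S| = #|Y|.
  apply/eqP; rewrite -(eqn_pmul2l (cardG_gt0 N)) -(eqn_pmul2r (cardG_gt0 P)).
  rewrite -(TI_cardMg tiNS) defE -(pHall_mul_normal nNE pqEN hallH).
  by rewrite -mulnA (mulnC #|Y|) -(TI_cardMg tiPY) defH mul_cardG.
(* S and Y are both complements of the {p,q}'-group C in N_E(R), hence conjugate; so S lies in a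
   conjugate of H and equals it by maximality. *)
have [|||||x Cx defY] := @SchurZassenhaus_trans_actsol _ C S Y.
- exact: pair_group_solvable.
- exact: subset_trans sSM (normal_norm nCM).
- rewrite joingC norm_joinEr ?(subset_trans sSM (normal_norm nCM)) // defM.
  by rewrite setSI.
- by rewrite coprime_sym (pnat_coprime pqS).
- exact: cardS.
have Ex : x^-1 \in E by rewrite groupV (subsetP sNE) // (subsetP sCN).
have hallHx : pq.-Hall(E) (H :^ x^-1) by rewrite pHallJ.
rewrite -(group_inj (maxS' (H :^ x^-1)%G _ _)) //.
  by rewrite /psubgroup; case/and3P: hallHx => -> ->.
by rewrite -sub_conjg -[_ :^ _]defY subsetIl.
Qed.

(** In J = N S, a maximal {p,q}-subgroup X containing S is Hall in J. So is H ∩ J, and the two are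
    conjugate in J. *)
Lemma pair_Hall_dominates_normal gT (E N H S : {group gT}) :
  N <| E -> q^'.-group N -> pq.-group (E / N) -> pq.-Hall(E) H ->
  S \subset E -> pq.-group S -> exists2 x, x \in E & S \subset H :^ x.
Proof.
move=> nNE q'N pqEN hallH sSE pqS; have [sNE nNE'] := andP nNE.
have nNS := subset_trans sSE nNE'; pose J := (N <*> S)%G.
have defJ : N * S = J by rewrite -norm_joinEr.
have sJE : J \subset E by rewrite join_subG sNE.
have sNJ : N \subset J := joing_subl _ _.
have nNJ : N <| J := normalS sNJ sJE nNE.
have [X maxX sSX] : {X : {group gT} | [max X | pq.-subgroup(J) X] & S \subset X}.
  by apply: maxgroup_exists; rewrite /psubgroup joing_subr.
have sXJ : X \subset J by have /andP[] := maxgroupp maxX.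
have defNX : N * X = J.
  by apply/eqP; rewrite eqEsubset mulG_subG sNJ sXJ -{1}defJ mulgS.
have hallX := max_pair_group_Hall nNJ q'N defNX maxX.
have hallHJ : pq.-Hall(J) (H :&: J)%G.
  apply: (@pHall_mul _ _ _ N).
  - by rewrite group_modl // (pHall_mul_normal nNE pqEN hallH) (setIidPr sJE).
  - exact: pgroupS (subsetIl _ _) (pHall_pgroup hallH).
  - have /= -> : N :&: (H :&: J) = N :&: H.
      by rewrite setIC -setIA (setIidPr sNJ) setIC.
    exact: pHall_setI_normal nNE hallH.
have pqJN : pq.-group (J / N) := pgroupS (quotientS _ sJE) pqEN.
have [x Jx defX] := pair_Hall_conj_normal nNJ q'N pqJN hallHJ hallX.
exists x; first exact: subsetP sJE x Jx.
by apply: subset_trans sSX _; rewrite defX conjSg subsetIl.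
Qed.

End PairHall.

(** * P. Hall's property D_pi and its passage through extensions *)

Definition Hall_dominated (pi : nat_pred) (gT : finGroupType) (G : {group gT}) :=
  exists2 H : {group gT}, pi.-Hall(G) H &
    forall S : {group gT}, S \subset G -> pi.-group S ->
      exists2 x, x \in G & S \subset H :^ x.

Lemma eq_Hall_dominated (pi rho : nat_pred) (gT : finGroupType) (G : {group gT}) :
  pi =i rho -> Hall_dominated pi G -> Hall_dominated rho G.
Proof.
move=> eq_pr [H hallH domH]; exists H; first by rewrite -(eq_pHall _ _ eq_pr).
by move=> S sSG; rewrite -(eq_pgroup _ eq_pr); apply: domH.
Qed.

(** With E the preimage of a Hall subgroup of G / N, a pi-subgroup of G is first conjugated into E
    by D_pi in G / N, then into H by D_pi in E. *)
Lemma Hall_dominated_ext (pi : nat_pred) (gT : finGroupType) (G N : {group gT}) :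
  N <| G -> Hall_dominated pi (G / N) ->
  (forall E : {group gT}, N <| E -> pi.-group (E / N) -> Hall_dominated pi E) ->
  Hall_dominated pi G.
Proof.
move=> nNG [Hb hallHb domHb] domE; have [sNG nNG'] := andP nNG.
pose E := (coset N @*^-1 Hb)%G; have sNE : N \subset E := sub_cosetpre _.
have sEG : E \subset G by rewrite sub_cosetpre_quo ?(pHall_sub hallHb).
have defEN : E / N = Hb := cosetpreK _.
have [||H hallH domH] := domE E; first exact: normalS sNE sEG nNG.
  by rewrite /= defEN (pHall_pgroup hallHb).
have sHE := pHall_sub hallH.
exists H => [|S sSG piS].
  rewrite /pHall (subset_trans sHE sEG) (pHall_pgroup hallH) /=.
  rewrite -(Lagrange_index sEG sHE) pnatM; case/and3P: hallH => _ _ ->.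
  rewrite andbT -(index_quotient_eq (H := N)) //.
    by rewrite /= defEN; case/and3P: hallHb.
  by rewrite subIset ?sNE ?orbT.
have [xb Gxb sSHx] := domHb (S / N)%G (quotientS _ sSG) (quotient_pgroup _ piS).
have [x nNx Gx defx] := morphimP Gxb.
have sSE : S :^ x^-1 \subset E.
  rewrite sub_conjgV -(quotientSGK (H := N) (G := (E :^ x)%G)) ?(subset_trans sSG) //.
    by rewrite quotientJ //= defEN -defx.
  by rewrite -(normP nNx) conjSg.
have [y Ey sSHy] := domH (S :^ x^-1)%G sSE (etrans (pgroupJ _ _ _) piS).
exists (y * x); first by rewrite groupM // (subsetP sEG).
by rewrite conjsgM -sub_conjgV.
Qed.

Section PairDominated.

Variables p q : nat.
Local Notation pq := (pair_pred p q).
Local Notation tau := (fun b : bool => if b then p^' : nat_pred else q^' : nat_pred).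

(** The family [tau] consists of the overlapping classes p' and q'. A non-trivial normal p'- or
    q'-subgroup starts the induction; the two cases differ by exchanging p and q. *)
Lemma pair_Hall_dominated (gT : finGroupType) (G : {group gT}) :
  primary_series tau G -> Hall_dominated pq G.
Proof.
have [n] := ubnP #|G|; elim: n => // n IH in gT G *; rewrite ltnS => leGn serG.
have [G1 | ntG] := eqVneq (G : {set gT}) 1.
  exists G => [|S sSG _]; first by rewrite pHallE subxx G1 cards1 part_p'nat.
  by exists 1; rewrite ?conjsg1.
have [N [nNG ntN p'q'N]] : exists N : {group gT},
    [/\ N <| G, N :!=: 1 & p^'.-group N \/ q^'.-group N].
  have [b ntN] := primary_series_pcore serG ntG.
  case: b ntN => /= ntN; [exists 'O_p^'(G)%G | exists 'O_q^'(G)%G]; split=> //;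
    by [exact: pcore_normal | left; apply: pcore_pgroup | right; apply: pcore_pgroup].
apply: (Hall_dominated_ext nNG).
  apply: IH; last exact: primary_series_quotient serG (normal_norm nNG).
  by apply: leq_trans leGn; rewrite ltn_quotient ?normal_sub.
move=> E nNE pqEN; case: p'q'N => piN.
  apply: (eq_Hall_dominated (pair_predC q p)).
  rewrite (eq_pgroup _ (pair_predC p q)) in pqEN.
  have [H hallH] := pair_Hall_exists_normal nNE piN pqEN.
  by exists H => // S; apply: pair_Hall_dominates_normal nNE piN pqEN hallH.
have [H hallH] := pair_Hall_exists_normal nNE piN pqEN.
by exists H => // S; apply: pair_Hall_dominates_normal nNE piN pqEN hallH.
Qed.

End PairDominated.

(** * Traces of a coprime action on an abelian group *)

Section Averaging.

Import ssralg GRing.Theory FiniteModule.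
Local Open Scope ring_scope.

(** Every element x0 y0 of X Y is a product x y in |X ∩ Y| ways, with x running through the coset x0
    (X ∩ Y). *)
Lemma sum_mulg (gT : finGroupType) (V : zmodType)
    (Q X Y : {group gT}) (F : gT -> V) :
  (X * Y)%g = Q ->
  \sum_(x in X) \sum_(y in Y) F (x * y)%g = (\sum_(q in Q) F q) *+ #|X :&: Y|.
Proof.
move=> defQ; have sXQ : X \subset Q by rewrite -defQ mulG_subl.
have sYQ : Y \subset Q by rewrite -defQ mulG_subr.
transitivity (\sum_(x in X) \sum_(q in Q | (x^-1 * q)%g \in Y) F q).
  apply: eq_bigr => x Xx; rewrite (reindex_inj (mulgI x^-1%g)) /=.
  apply: eq_big => [q | q _]; last by rewrite mulKVg.
  case Yq: (_ \in Y); rewrite ?andbF // andbT.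
  by rewrite -(mulKVg x q) (groupM (subsetP sXQ x Xx) (subsetP sYQ _ Yq)).
rewrite (exchange_big_dep [in Q]) => [|x q _ /andP[]//] /=.
rewrite -sumrMnl; apply: eq_bigr => q Qq.
rewrite sumr_const; congr (_ *+ _).
have:= Qq; rewrite -{1}defQ => /imset2P[x0 y0 Xx0 Yy0 defq].
rewrite -(card_lcoset (X :&: Y) x0); apply: eq_card => x.
rewrite unfold_in mem_lcoset in_setI Qq /= defq mulgA (groupMr _ Yy0).
by rewrite (groupMl _ (groupVr Xx0)) -(groupV Y (x0^-1 * x)%g) invgM invgK.
Qed.

Variables (gT : finGroupType) (N Q : {group gT}).
Hypotheses (abN : abelian N) (nNQ : Q \subset 'N(N)) (coNQ : coprime #|N| #|Q|).

(* For v in C_N(Y), v = u w with u in C_N(X) and w in C_N(Z), the Y-trace of v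
   is v ^+ #|Y|, while up to a factor coprime to |N| the Y-traces of u and of w
   are their Q-traces. *)
Lemma cent_factorization_cent (X Y Z : {group gT}) :
  (X * Y)%g = Q -> (Z * Y)%g = Q -> N \subset ('C_N(X) * 'C_N(Z))%g ->
  'C_N(Y)%g \subset 'C(Q).
Proof.
move=> defXY defZY sN.
have [sXQ sYQ] : X \subset Q /\ Y \subset Q by rewrite -defXY mulG_subl mulG_subr.
have sZQ : Z \subset Q by rewrite -defZY mulG_subl.
have nN (S : {group gT}) x : S \subset Q -> x \in S -> x \in 'N(N).
  by move=> sSQ Sx; apply: (subsetP nNQ); apply: (subsetP sSQ).
pose tr (S : {group gT}) n := \sum_(s in S) actr (fmod abN n) s.
have tr_fix (S : {group gT}) n : S \subset Q -> n \in 'C_N(S)%g ->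
    tr S n = fmod abN n *+ #|S|.
  move=> sSQ /setIP[Nn cSn]; rewrite -sumr_const; apply: eq_bigr => s Ss.
  by rewrite -fmodJ ?(nN S) // conjgE (centP cSn _ Ss) mulKg.
have tr_mul (X0 : {group gT}) n : (X0 * Y)%g = Q -> n \in 'C_N(X0)%g ->
    tr Y n *+ #|X0| = tr Q n *+ #|X0 :&: Y|.
  move=> defX0Y X0n; rewrite /tr -(sum_mulg _ defX0Y) -sumr_const.
  apply: eq_bigr => x X0x; apply: eq_bigr => y Yy.
  have sX0Q : X0 \subset Q by rewrite -defX0Y mulG_subl.
  have /setIP[Nn cn] := X0n.
  rewrite actrM ?(nN _ _ sX0Q X0x) ?(nN Y) // -(fmodJ _ _ (nN _ _ sX0Q X0x)).
  by rewrite conjgE (centP cn _ X0x) mulKg.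
have trQ n g : g \in Q -> actr (tr Q n) g = tr Q n.
  move=> Qg; rewrite /tr actr_sum [RHS](reindex_inj (mulIg g)) /=.
  apply: eq_big => [q | q Qq]; first by rewrite groupMr.
  by rewrite actrM ?(nN Q).
apply/subsetP => v Yv; have /setIP[Nv _] := Yv; apply/centP => g Qg.
have /imset2P[u w Xu Zw defv] := subsetP sN v Nv.
have [/setIP[Nu _] /setIP[Nw _]] := (Xu, Zw).
have trD : tr Y v = tr Y u + tr Y w.
  by rewrite /tr -big_split; apply: eq_bigr => y Yy; rewrite /= defv fmodM // actAr.
(* The factor |Y| comes from the trace of v, which Y fixes; |X| and |Z| turn the Y-traces of u and w
   into multiples of Q-invariant Q-traces. All three divide |Q|, so taking k-th powers is injective
   on N. *)
set k := (#|Y| * (#|X| * #|Z|))%N.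
have defk : fmod abN v *+ k =
    tr Q u *+ (#|X :&: Y| * #|Z|) + tr Q w *+ (#|Z :&: Y| * #|X|).
  by rewrite !mulrnA -(tr_fix Y) // trD -!tr_mul // -!mulrnA [(#|Z| * _)%N]mulnC -mulrnDl.
have fixk : fmod abN ((v ^ g) ^+ k)%g = fmod abN (v ^+ k)%g.
  have nNg : g \in 'N(N) := nN Q g (subxx _) Qg.
  rewrite -conjXg fmodJ // fmodX // defk.
  rewrite actAr !actZr !trQ //.
have Nvg : (v ^ g)%g \in N by rewrite memJ_norm ?(nN Q).
have := injmP (injm_fmod abN) _ _ (groupX k Nvg) (groupX k Nv) fixk.
have cok : coprime #|N| k.
  rewrite !coprimeMr !(coprime_dvdr _ coNQ) ?cardSg //.
move/(congr1 (fun z => z ^+ expg_invn N k)%g); rewrite !(expgK cok) //.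
by move/conjg_fixP/commgP.
Qed.

End Averaging.

(** * Conjugates, centralisers and Hall subgroups in a factorised group *)

Lemma conj_factorization (gT : finGroupType) (E A B : {group gT}) x y :
  A * B = E -> x \in E -> y \in E -> (A :^ x) * (B :^ y) = E.
Proof.
move=> defE Ex Ey; have Ez : x * y^-1 \in E by rewrite groupM ?groupV.
apply: (conjsg_inj (x := y^-1)); rewrite conjsMg -!conjsgM mulgV conjsg1.
(* With x y^-1 = a b, the product of A^(a b) = A^b and B = B^b is E^b = E. *)
rewrite (conjGid (groupVr Ey)); move: Ez; rewrite -{1}defE.
case/imset2P=> a b Aa Bb ->; rewrite conjsgM (conjGid Aa) -[X in _ * X](conjGid Bb).
by rewrite -conjsMg defE conjGid // -defE (subsetP (mulG_subr A B)).
Qed.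

(* For n in N write n = b a with a in A and b in B: then X ^ a = X and
   Y ^ a = Y ^ n. Modulo N, a agrees with some m in N_E(Q), which must
   normalise X and Y. *)
Lemma normal_factorization_cent (gT : finGroupType) (E N Q A B X Y : {group gT}) :
  N <| E -> Q \subset E -> N * 'N_E(Q) = E -> N :&: Q = 1 -> A * B = E ->
  X <| A -> Y <| B -> X \subset Q -> Y \subset Q -> N \subset 'C_N(Y) * 'C_N(X).
Proof.
move=> nNE sQE defE tiNQ defAB nXA nYB sXQ sYQ; have [sNE nNE'] := andP nNE.
(* The conjugate Z^z lies in Q, and as Z^k it lies in Z N; by the modular law Z N ∩ Q = Z (N ∩ Q) =
   Z. *)
have sub_id (Z : {group gT}) k z : Z \subset Q -> k \in N -> z \in 'N(Q) ->
    Z :^ z = Z :^ k -> Z :^ z = Z.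
  move=> sZQ Nk nQz eqZ.
  have nNk : k \in 'N(N) := subsetP (normG N) k Nk.
  apply/eqP; rewrite eqEcard cardJg leqnn andbT.
  suff: Z :^ z \subset Z * N :&: Q by rewrite -group_modl // tiNQ mulg1.
  rewrite subsetI; apply/andP; split; last by rewrite -(normP nQz) conjSg.
  rewrite eqZ; apply/subsetP => _ /imsetP[t Zt ->].
  rewrite -norm_joinEl ?(subset_trans (subset_trans sZQ sQE)) //.
  by rewrite groupJ ?mem_gen ?inE ?Zt ?Nk ?orbT.
have cent_norm (Z : {group gT}) : Z \subset Q -> N :&: 'N(Z) \subset 'C_N(Z).
  move=> sZQ; rewrite subsetI subsetIl /= centsC; apply/commG1P/trivgP.
  rewrite -tiNQ /= commGC; apply: subset_trans (_ : N :&: Z \subset _); last exact: setIS.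
  by rewrite commg_subI // subsetI subxx (subset_trans (subset_trans sZQ sQE)).
apply/subsetP => n Nn; have := subsetP sNE n Nn; rewrite -(mulG_comm defAB).
case/imset2P=> b a Bb Aa defn.
have Ea : a \in E by rewrite -defAB (subsetP (mulG_subl B A)).
have XaX : X :^ a = X := normsP (normal_norm nXA) a Aa.
have YaY : Y :^ a = Y :^ n by rewrite defn conjsgM (normsP (normal_norm nYB) b Bb).
have: a \in 'N_E(Q) * N by rewrite (mulG_comm defE).
case/imset2P=> m k /setIP[Em nQm] Nk defa.
have Xm : X :^ m = X.
  apply: (sub_id _ k^-1) => //; rewrite ?groupV //.
  by rewrite -{2}XaX defa conjsgM conjsgK.
have Ym : Y :^ m = Y.
  apply: (sub_id _ (n * k^-1)) => //; rewrite ?groupM ?groupV //.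
  by rewrite conjsgM -YaY defa conjsgM conjsgK.
have Xk : k \in 'C_N(X).
  apply: (subsetP (cent_norm X sXQ)); rewrite in_setI Nk.
  by apply/normP; rewrite -{2}XaX defa conjsgM Xm.
have Yk : n * k^-1 \in 'C_N(Y).
  apply: (subsetP (cent_norm Y sYQ)); rewrite in_setI groupM ?groupV //=.
  by apply/normP; rewrite conjsgM -YaY defa conjsgM Ym conjsgK.
by rewrite -[n](mulgKV k) mem_mulg.
Qed.

(** By orders: |X| |Y| is the pi-part of |A| |B| = |E| |A ∩ B|, hence at least |Q| |X ∩ Y|. *)
Lemma Hall_mul (pi : nat_pred) (gT : finGroupType) (E A B X Y Q : {group gT}) :
  A * B = E -> pi.-Hall(A) X -> pi.-Hall(B) Y -> pi.-Hall(E) Q ->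
  X \subset Q -> Y \subset Q -> X * Y = Q.
Proof.
move=> defE sylX sylY sylQ sXQ sYQ; apply/eqP; rewrite eqEcard mul_subG //=.
rewrite -(leq_pmul2r (cardG_gt0 (X :&: Y)%G)) -mul_cardG.
rewrite (card_Hall sylX) (card_Hall sylY) (card_Hall sylQ).
rewrite -partnM // mul_cardG defE partnM ?cardG_gt0 // leq_pmul2l ?part_gt0 //.
rewrite -(part_pnat_id (n := #|X :&: Y|) (pi := pi)).
  rewrite dvdn_leq ?part_gt0 // partn_dvd // cardSg // setISS //.
    exact: pHall_sub sylX.
  exact: pHall_sub sylY.
exact: pgroupS (subsetIl _ _) (pHall_pgroup sylX).
Qed.

(** * Normal Sylow q-subgroups in triple factorisations *)

Section SylowClosed.

Variable q : nat.
Implicit Types gT : finGroupType.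

Lemma quotient_Sylow_pcore gT (A N : {group gT}) :
  A \subset 'N(N) -> q.-Sylow(A) 'O_q(A) -> q.-Sylow(A / N) 'O_q(A / N).
Proof.
move=> nNA sylA.
have sylAN : q.-Sylow(A / N) ('O_q(A) / N).
  by apply: quotient_pHall sylA; apply: subset_trans (pcore_sub _ _) nNA.
by rewrite (normal_Hall_pcore sylAN) // quotient_normal // pcore_normal.
Qed.

(** After conjugating A, B and C, their normal Sylow q-subgroups X, Y, Z lie in Q and multiply in
    pairs to Q, while N is the product of any two of C_N(X), C_N(Y), C_N(Z). Averaging then puts
    C_N(X) and C_N(Y), hence N, into C(Q). *)
Lemma trifactorization_cent gT (E N Q A B C : {group gT}) :
  N <| E -> abelian N -> q^'.-group N -> q.-Sylow(E) Q -> N <*> Q <| E ->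
  A * B = E -> B * C = E -> A * C = E ->
  q.-Sylow(A) 'O_q(A) -> q.-Sylow(B) 'O_q(B) -> q.-Sylow(C) 'O_q(C) ->
  Q \subset 'C(N).
Proof.
move=> nNE abN q'N sylQ nNQE defAB defBC defAC.
have [sNE nNE'] := andP nNE; have /and3P[sQE qQ _] := sylQ.
have conjQ (D : {group gT}) : D \subset E -> q.-Sylow(D) 'O_q(D) ->
    exists x, exists Y : {group gT},
      [/\ x \in E, Y <| D :^ x, q.-Sylow(D :^ x) Y & Y \subset Q].
  move=> sDE sylD.
  have [x Ex sOQ] := Sylow_Jsub sylQ (subset_trans (pcore_sub q D) sDE) (pcore_pgroup q D).
  exists x, ('O_q(D) :^ x)%G; split=> //; last by rewrite pHallJ2.
  by rewrite normalJ pcore_normal.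
have [sAE sBE] : A \subset E /\ B \subset E by rewrite -defAB mulG_subl mulG_subr.
have sCE : C \subset E by rewrite -defAC mulG_subr.
move=> /(conjQ A sAE)[a [X [Ea nXA sylX sXQ]]].
move=> /(conjQ B sBE)[b [Y [Eb nYB sylY sYQ]]].
move=> /(conjQ C sCE)[c [Z [Ec nZC sylZ sZQ]]].
have {}defAB := conj_factorization defAB Ea Eb.
have {}defBC := conj_factorization defBC Eb Ec.
have {}defAC := conj_factorization defAC Ea Ec.
have coNQ : coprime #|N| #|Q| by rewrite coprime_sym (pnat_coprime qQ q'N).
have tiNQ : N :&: Q = 1 := coprime_TIg coNQ.
have nNQ : Q \subset 'N(N) := subset_trans sQE nNE'.
(* The Frattini argument for Q in the normal subgroup N Q; the factor Q is absorbed by N_E(Q). *)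
have defE : N * 'N_E(Q) = E.
  have sylQ' : q.-Sylow(N <*> Q) Q := pHall_subl (joing_subr _ _) (normal_sub nNQE) sylQ.
  have /= := Frattini_arg nNQE sylQ'; rewrite norm_joinEr // -mulgA mulSGid //.
  by rewrite subsetI sQE normG.
have defXY := Hall_mul defAB sylX sylY sylQ sXQ sYQ.
have defYZ := Hall_mul defBC sylY sylZ sylQ sYQ sZQ.
have defXZ := Hall_mul defAC sylX sylZ sylQ sXQ sZQ.
have cN := normal_factorization_cent nNE sQE defE tiNQ.
have sYX := cN _ _ _ _ defAB nXA nYB sXQ sYQ.
have sZY := cN _ _ _ _ defBC nYB nZC sYQ sZQ.
have sZX := cN _ _ _ _ defAC nXA nZC sXQ sZQ.
have cY : 'C_N(Y) \subset 'C(Q).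
  exact: (cent_factorization_cent abN nNQ coNQ (mulG_comm defYZ) defXY sZX).
have cX : 'C_N(X) \subset 'C(Q).
  exact: (cent_factorization_cent abN nNQ coNQ (mulG_comm defXZ) (mulG_comm defXY) sZY).
by rewrite centsC (subset_trans sYX) // mul_subG.
Qed.

(* If O_q(E) = 1, a Sylow q-subgroup Q centralises a normal abelian
   q'-subgroup N; as Q N is normal in E by induction, so is Q. *)
Lemma trifactorization_Sylow_pcore gT (E A B C : {group gT}) :
  solvable E ->
  A * B = E -> B * C = E -> A * C = E ->
  q.-Sylow(A) 'O_q(A) -> q.-Sylow(B) 'O_q(B) -> q.-Sylow(C) 'O_q(C) ->
  q.-Sylow(E) 'O_q(E).
Proof.
have [n] := ubnP #|E|; elim: n => // n IH in gT E A B C *; rewrite ltnS => leEn.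
move=> solE defAB defBC defAC clA clB clC.
have IHq (N : {group gT}) : N <| E -> N :!=: 1 -> q.-Sylow(E / N) 'O_q(E / N).
  move=> nNE ntN; have [sNE nNE'] := andP nNE.
  have [sAE sBE] : A \subset E /\ B \subset E by rewrite -defAB mulG_subl mulG_subr.
  have sCE : C \subset E by rewrite -defAC mulG_subr.
  apply: (IH _ (E / N)%G (A / N)%G (B / N)%G (C / N)%G) => //.
  - by apply: leq_trans leEn; rewrite ltn_quotient.
  - exact: quotient_sol.
  - by rewrite -quotientMl ?defAB // (subset_trans sAE).
  - by rewrite -quotientMl ?defBC // (subset_trans sBE).
  - by rewrite -quotientMl ?defAC // (subset_trans sAE).
  - by apply: quotient_Sylow_pcore clA; apply: subset_trans sAE nNE'.
  - by apply: quotient_Sylow_pcore clB; apply: subset_trans sBE nNE'.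
  - by apply: quotient_Sylow_pcore clC; apply: subset_trans sCE nNE'.
rewrite /pHall pcore_sub pcore_pgroup /=.
(* E / O_q(E) has trivial q-core, so by induction its Sylow q-subgroup is trivial. *)
have [O1 | ntO] := eqVneq 'O_q(E) 1; last first.
  have := IHq _ (pcore_normal q E) ntO.
  rewrite trivg_pcore_quotient => /and3P[_ _].
  by rewrite indexg1 card_quotient ?gFnorm.
have [E1 | ntE] := eqVneq (E : {set gT}) 1.
  by rewrite -indexgI E1 (setIidPl (sub1G _)) indexgg.
have [N [sNE nNE ntN /is_abelemP[r r_pr abN]]] := solvable_norm_abelem solE (normal_refl E) ntE.
have rN := abelem_pgroup abN.
have q'N : q^'.-group N.
  have [rq | ne_rq] := eqVneq r q; last first.
    by apply: sub_in_pnat rN => s _; rewrite !inE => /eqP->.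
  case/negP: ntN; rewrite -subG1 -O1 pcore_max // -rq //.
have [Q sylQ] := Sylow_exists q E; have /and3P[sQE qQ q'EQ] := sylQ.
have nNQ := subset_trans sQE (normal_norm nNE).
have nNQE : N <*> Q <| E.
  rewrite -(quotientGK nNE) -(quotientGK (H := N) (G := (N <*> Q)%G)); last first.
    by rewrite /normal joing_subl join_subG normG.
  rewrite cosetpre_normal quotientYidl //.
  have sylQN : q.-Sylow(E / N) (Q / N) := quotient_pHall nNQ sylQ.
  by have /= -> := eq_Hall_pcore (IHq N nNE ntN) sylQN; apply: pcore_normal.
have cNQ := trifactorization_cent nNE (abelem_abelian abN) q'N sylQ nNQE
  defAB defBC defAC clA clB clC.
have nQNQ : Q <| N <*> Q.
  by rewrite /normal joing_subr join_subG normG andbT cents_norm // centsC.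
have sylQ' : q.-Sylow(N <*> Q) Q := pHall_subl (joing_subr _ _) (normal_sub nNQE) sylQ.
have nQE : Q <| E.
  by rewrite -(normal_Hall_pcore sylQ' nQNQ) (char_normal_trans (pcore_char _ _)).
by apply: pnat_dvd q'EQ; apply: indexgS; apply: pcore_max.
Qed.

End SylowClosed.

(** * Non-centralising pairs of a p-subgroup and a q-subgroup *)

Section NoPair.

Variables p q : nat.
Implicit Types gT : finGroupType.
Local Notation pq := (pair_pred p q).

Definition no_pair gT (G : {group gT}) :=
  forall P Q : {group gT}, P \subset G -> Q \subset G -> p.-group P ->
    q.-group Q -> Q \subset 'N(P) -> Q \subset 'C(P).

(** A Sylow p-subgroup P of the preimage of [Pb] maps onto [Pb]. By Frattini N_Y(P) covers [Pb]
    [Qb], so a Sylow q-subgroup of N_Y(P) maps onto a Sylow q-subgroup there, a conjugate of which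
    contains [Qb]. *)
Lemma no_pair_quotient gT (G W : {group gT}) :
  W <| G -> no_pair G -> no_pair (G / W).
Proof.
move=> nWG noG Pb Qb sPG sQG pP qQ nPQ; have [sWG nWG'] := andP nWG.
pose X := (coset W @*^-1 Pb)%G; pose Y := (coset W @*^-1 (Pb <*> Qb))%G.
have sXG : X \subset G by rewrite sub_cosetpre_quo.
have sYG : Y \subset G by rewrite sub_cosetpre_quo ?join_subG ?sPG.
have nXY : X <| Y.
  by rewrite cosetpre_normal /normal joing_subl join_subG normG.
have [P sylP] := Sylow_exists p X; have [sPX pP0 p'P] := and3P sylP.
have sWX : W \subset X := sub_cosetpre _.
have nWX : X \subset 'N(W) := subset_trans sXG nWG'.
have nWY : Y \subset 'N(W) := subset_trans sYG nWG'.
have defPb : P / W = Pb.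
  have sylPW : p.-Sylow(X / W) (P / W) := quotient_pHall (subset_trans sPX nWX) sylP.
  rewrite cosetpreK in sylPW; apply/eqP; rewrite eqEcard (pHall_sub sylPW) /=.
  by rewrite (card_Hall sylPW) part_pnat_id.
pose M := 'N_Y(P)%G; have [Q sylQ] := Sylow_exists q M.
have [sQM qQ0 _] := and3P sylQ.
have sPY : P \subset Y := subset_trans sPX (normal_sub nXY).
have sPM : P \subset M by rewrite subsetI sPY normG.
have sMY : M \subset Y := subsetIl _ _.
have defMW : M / W = Pb <*> Qb.
  have defY : Y / W = Pb <*> Qb := cosetpreK _.
  rewrite -defY -(Frattini_arg nXY sylP) quotientMl //.
  have -> : X / W = Pb := cosetpreK _.
  by rewrite mulSGid // -defPb quotientS.
have sylQW : q.-Sylow(M / W) (Q / W).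
  by apply: quotient_pHall sylQ; apply: subset_trans sQM (subset_trans sMY nWY).
rewrite defMW in sylQW.
have [x Yx sQx] := Sylow_subJ sylQW (joing_subr Pb Qb) qQ.
have cPQ : Q \subset 'C(P).
  apply: noG => //; first exact: subset_trans sPX sXG.
    exact: subset_trans sQM (subset_trans sMY sYG).
  exact: subset_trans sQM (subsetIr _ _).
have nPx : x \in 'N(Pb).
  by apply: subsetP Yx; rewrite join_subG normG.
apply: subset_trans sQx _; rewrite -(normP nPx) centJ conjSg -defPb.
exact: quotient_cents.
Qed.

(** Q lies in O_q(G), so [P, Q] is contained in P ∩ O_q(G) = 1. *)
Lemma Sylow_pcore_no_pair gT (G : {group gT}) :
  p != q -> q.-Sylow(G) 'O_q(G) -> no_pair G.
Proof.
move=> ne_pq hallO P Q sPG sQG pP qQ nPQ.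
have sQO : Q \subset 'O_q(G) by rewrite sub_Hall_pcore.
have q'P : q^'.-group P.
  by apply: sub_in_pnat pP => r _; rewrite !inE => /eqP->.
have tiPO : P :&: 'O_q(G) = 1.
  by rewrite setIC; apply: coprime_TIg; apply: pnat_coprime (pcore_pgroup _ _) q'P.
apply/commG1P/trivgP; rewrite -tiPO /= commGC commg_subI // subsetI ?subxx ?sQO //.
by rewrite (subset_trans sPG) ?gFnorm.
Qed.

(* In D = E / O_q(E) the subgroup O_p(D) contains its centraliser, hence all
   the q-elements. *)
Lemma no_pair_Sylow_pcore gT (E : {group gT}) :
  p != q -> pq.-group E -> no_pair E -> q.-Sylow(E) 'O_q(E).
Proof.
move=> ne_pq pqE noE; pose D := (E / 'O_q(E))%G.
have pqD : pq.-group D := quotient_pgroup _ pqE.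
have solD : solvable D := pair_group_solvable pqD.
have noD : no_pair D := no_pair_quotient (pcore_normal _ _) noE.
have [Q sylQ] := Sylow_exists q D; have /and3P[sQD qQ q'DQ] := sylQ.
have sO : 'O_p^'(D) \subset 'O_q(D).
  apply: pcore_max (pcore_normal _ _).
  have pqO : pq.-group 'O_p^'(D) := pgroupS (pcore_sub _ _) pqD.
  have p'O : p^'.-group 'O_p^'(D) := pcore_pgroup _ _.
  by rewrite /pgroup (eq_pnat _ (pair_predC p q)) in pqO; apply: pair_nat_p pqO p'O.
rewrite /= trivg_pcore_quotient in sO.
have sOD : 'C_D('O_p(D)) \subset 'O_p(D).
  exact: cent_pcore_sub_pcore (solvable_primary_series p solD) (trivgP sO).
have cQ : Q \subset 'C('O_p(D)).
  by apply: noD; rewrite ?pcore_sub ?pcore_pgroup // (subset_trans sQD) ?gFnorm.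
have pQ : p.-group Q.
  by apply: pgroupS (pcore_pgroup p D); apply: subset_trans sOD; rewrite subsetI sQD.
have q'Q : q^'.-group Q.
  by apply: sub_in_pnat pQ => r _; rewrite !inE => /eqP->.
rewrite (card1_trivg (pnat_1 qQ q'Q)) indexg1 in q'DQ.
by rewrite /pHall pcore_sub pcore_pgroup /= -card_quotient ?gFnorm.
Qed.

End NoPair.

Lemma no_pair_sub p q (gT : finGroupType) (G H : {group gT}) :
  H \subset G -> no_pair p q G -> no_pair p q H.
Proof. by move=> sHG noG P Q sPH sQH; apply: noG; apply: subset_trans sHG. Qed.

Lemma no_pair_conj p q (gT : finGroupType) (G : {group gT}) x :
  no_pair p q G -> no_pair p q (G :^ x).
Proof.
move=> noG P Q sPG sQG pP qQ nPQ; rewrite -(conjSg _ _ x^-1) -centJ.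
apply: (noG (P :^ x^-1)%G (Q :^ x^-1)%G); rewrite ?pgroupJ ?sub_conjgV //.
by rewrite /= -normJ conjsgKV.
Qed.

Lemma Hall_dominated_conj (pi : nat_pred) (gT : finGroupType) (G E A : {group gT}) :
  A \subset G ->
  (forall S : {group gT}, S \subset G -> pi.-group S ->
     exists2 x, x \in G & S \subset E :^ x) ->
  Hall_dominated pi A ->
  exists x, exists X : {group gT}, [/\ x \in G, X \subset E & pi.-Hall(A :^ x) X].
Proof.
move=> sAG domE [X hallX _]; have [sXA piX _] := and3P hallX.
have [x Gx sXE] := domE X (subset_trans sXA sAG) piX.
exists x^-1, (X :^ x^-1)%G; rewrite groupV Gx sub_conjgV sXE; split=> //.
by rewrite pHallJ2.
Qed.

(** By D_{p,q} suitable conjugates of A, B, C have Hall {p,q}-subgroups X, Y, Z inside a Hall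
    subgroup E of G, and E = X Y = Y Z = X Z. So E has a normal Sylow q-subgroup, and any pair P, Q
    of G generates a {p,q}-group conjugate into E. *)
Lemma no_pair_factorization p q (gT : finGroupType) (G A B C : {group gT}) :
  p != q -> A * B = G -> B * C = G -> A * C = G ->
  Hall_dominated (pair_pred p q) G -> Hall_dominated (pair_pred p q) A ->
  Hall_dominated (pair_pred p q) B -> Hall_dominated (pair_pred p q) C ->
  no_pair p q A -> no_pair p q B -> no_pair p q C -> no_pair p q G.
Proof.
move=> ne_pq defAB defBC defAC [E hallE domE] domA domB domC noA noB noC.
have [sAG sBG] : A \subset G /\ B \subset G by rewrite -defAB mulG_subl mulG_subr.
have sCG : C \subset G by rewrite -defAC mulG_subr.
have [a [X [Ga sXE hallX]]] := Hall_dominated_conj sAG domE domA.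
have [b [Y [Gb sYE hallY]]] := Hall_dominated_conj sBG domE domB.
have [c [Z [Gc sZE hallZ]]] := Hall_dominated_conj sCG domE domC.
have {}defAB := conj_factorization defAB Ga Gb.
have {}defBC := conj_factorization defBC Gb Gc.
have {}defAC := conj_factorization defAC Ga Gc.
have pqE := pHall_pgroup hallE.
have closed (D W : {group gT}) x : no_pair p q D -> W \subset E ->
    (pair_pred p q).-Hall(D :^ x) W -> q.-Sylow(W) 'O_q(W).
  move=> noD sWE hallW; apply: (no_pair_Sylow_pcore ne_pq); first exact: pgroupS pqE.
  exact: no_pair_sub (pHall_sub hallW) (no_pair_conj noD).
have clE : q.-Sylow(E) 'O_q(E).
  apply: (trifactorization_Sylow_pcore (pair_group_solvable pqE)
    (Hall_mul defAB hallX hallY hallE sXE sYE)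
    (Hall_mul defBC hallY hallZ hallE sYE sZE)
    (Hall_mul defAC hallX hallZ hallE sXE sZE)).
  - exact: closed noA sXE hallX.
  - exact: closed noB sYE hallY.
  - exact: closed noC sZE hallZ.
have noE := Sylow_pcore_no_pair ne_pq clE.
move=> P Q sPG sQG pP qQ nPQ.
have pqS : (pair_pred p q).-group (P <*> Q).
  by rewrite norm_joinEr // pgroupM pair_group_p ?pair_group_q.
have sSG : P <*> Q \subset G by rewrite join_subG sPG.
have [x _ sSE] := domE (P <*> Q)%G sSG pqS.
apply: (no_pair_conj (x := x) noE) => //.
  exact: subset_trans (joing_subl _ _) sSE.
exact: subset_trans (joing_subr _ _) sSE.
Qed.

(** * Edges of the sigma-Vasil'ev-Murashko graph and its union formula *)

Section VasilevMurashko.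

Variables (I : Type) (sigma : I -> nat_pred).
Hypothesis sigma_part : prime_partition sigma.
Implicit Types gT : finGroupType.

Lemma block_group_disjoint gT (P : {group gT}) p i j :
  i <> j -> p \in sigma i -> p.-group P -> (sigma j)^'.-group P.
Proof.
move=> ne_ij pi; apply: sub_in_pnat => r _; rewrite inE => /eqP->.
exact: (block_disjoint sigma_part ne_ij pi).
Qed.

(* Every Sylow r-subgroup of D with r in sigma_j normalises, hence centralises,
   a Sylow p-subgroup of N for each prime p, hence it centralises N. *)
Lemma no_pair_normal_Hall_pi_nilpotent gT (D N : {group gT}) i j :
  i <> j -> N <| D -> (sigma i).-group N -> (sigma j).-nat #|D : N| ->
  (forall p q, p \in sigma i -> q \in sigma j -> no_pair p q D) ->
  pi_nilpotent (sigma i) D.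
Proof.
move=> ne_ij nND iN jDN noD; have [sND nND'] := andP nND.
have j_i' := block_disjoint sigma_part (nesym ne_ij).
apply: (central_Hall_pi_nilpotent nND iN).
  exact: sub_in_pnat (fun p _ => @j_i' p) jDN.
apply/pnatP => // r r_pr rDC.
have [// | rj] : r \in sigma i \/ r \in sigma j.
  have: r %| #|N| * #|D : N|.
    by rewrite Lagrange //; apply: dvdn_trans rDC (dvdn_indexg _ _).
  rewrite Euclid_dvdM // => /orP[rN | rN].
    by left; apply: (pnatPpi iN); rewrite mem_primes r_pr cardG_gt0.
  by right; apply: (pnatPpi jDN); rewrite mem_primes r_pr indexg_gt0.
have [R sylR] := Sylow_exists r D; have [sRD rR r'DR] := and3P sylR.
have coNR : coprime #|N| #|R|.
  exact: pnat_coprime iN (block_group_disjoint (nesym ne_ij) rj rR).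
have nNR := subset_trans sRD nND'.
have cNR : N \subset 'C(R).
  apply/setIidPl/eqP; rewrite eqEcard subsetIl /=.
  rewrite -(Lagrange (subsetIl N 'C(R))) -[X in _ <= X]muln1 leq_pmul2l //.
  rewrite leqNgt; apply/negP => gt1; have p_pr := pdiv_prime gt1.
  set p := pdiv _ in p_pr; have p_dvd : p %| #|N : N :&: 'C(R)| := pdiv_dvd _.
  have [P sylP nPR] := sol_coprime_Sylow_exists p (pgroup_sol rR) nNR coNR.
  have [sPN pP p'NP] := and3P sylP.
  have pi : p \in sigma i.
    apply: (pnatPpi iN); rewrite mem_primes p_pr cardG_gt0.
    exact: dvdn_trans p_dvd (dvdn_indexg _ _).
  have cRP := noD p r pi rj P R (subset_trans sPN sND) sRD pP rR nPR.
  move: p'NP; rewrite p'natE // => /negP[]; apply: dvdn_trans p_dvd _.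
  by rewrite indexgS // subsetI sPN centsC.
have := r'DR; rewrite p'natE // => /negP[]; apply: dvdn_trans rDC _.
by rewrite indexgS // subsetI sRD centsC.
Qed.

(** H has a proper normal subgroup K of sigma_k-index, and K is sigma-nilpotent by criticality. If k
    = i, then O_{i'}(K) would be a normal complement in H; so k <> i. Since K lies in F_i(H), the
    index of F_i(H) is a sigma_k-number and k = j. Without pairs, H / O_{i'}(K), and hence H, would
    be sigma_i-nilpotent. *)
Lemma critical_no_pair gT (H : {group gT}) i j :
  primary_series sigma H -> sigma_nilpotent_critical sigma H ->
  ~~ (sigma j)^'.-nat #|H : pi_Fitting (sigma i) H| ->
  i <> j /\ exists p q, [/\ p \in sigma i, q \in sigma j & ~ no_pair p q H].
Proof.
move=> serH [nonilH nilH] jHF.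
have nonil_i : ~ pi_nilpotent (sigma i) H.
  by rewrite -pi_Fitting_id => /eqP eqF; move: jHF; rewrite eqF indexgg.
have ntH : H :!=: 1.
  apply/eqP => H1; apply: nonil_i; apply: (pi_nilpotentI (normal1 H)).
    exact: pgroup1.
  by rewrite indexg1 H1 cards1.
have [K [nKH ltKH [k kHK]]] := primary_series_maxnormal serH ntH.
have /(sigma_nilpotentP sigma_part) nilK := nilH K ltKH.
have nWH l : 'O_(sigma l)^'(K) <| H by apply: char_normal_trans (pcore_char _ _) nKH.
have ne_ik : i <> k.
  move=> ik; apply: nonil_i; apply: (pi_nilpotentI (nWH i) (pcore_pgroup _ _)).
  by rewrite -(Lagrange_index (normal_sub nKH) (pcore_sub _ _)) pnatM [X in _ && X]nilK ik kHK.
have kHF : (sigma k).-nat #|H : pi_Fitting (sigma i) H|.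
  by apply: pnat_dvd kHK; rewrite indexgS // pi_Fitting_max.
have kj : k = j.
  by apply: (sigma_set_block sigma_part _ kHF); last exact/sigma_setE.
rewrite -{j}kj in jHF *; split=> //; apply: boolp.contrapT => nopair.
apply: nonil_i; apply: (pi_nilpotent_mod (nWH i) (pcore_pgroup _ _)).
apply: (no_pair_normal_Hall_pi_nilpotent (N := (K / 'O_(sigma i)^'(K))%G) ne_ik).
- exact: quotient_normal.
- by rewrite /pgroup card_quotient ?gFnorm //; apply: nilK.
- have sOK : H :&: 'O_(sigma i)^'(K) \subset K.
    exact: subset_trans (subsetIr _ _) (pcore_sub _ _).
  by rewrite (index_quotient_eq sOK (normal_sub nKH) (normal_norm (nWH i))).
move=> p q pi qk; apply: (no_pair_quotient (nWH i)).
by apply: boolp.contrapT => nop; apply: nopair; exists p, q.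
Qed.

Lemma sigma_nilpotent_critical_exists gT (S : {group gT}) :
  ~ sigma_nilpotent sigma S ->
  exists2 H : {group gT}, H \subset S & sigma_nilpotent_critical sigma H.
Proof.
have [n] := ubnP #|S|; elim: n => // n IH in S *; rewrite ltnS => leSn nonil.
have [[K ltKS nonilK] | noK] :=
  boolp.EM (exists2 K : {group gT}, K \proper S & ~ sigma_nilpotent sigma K).
  have [|H sHK critH] := IH K _ nonilK.
    exact: leq_trans (proper_card ltKS) leSn.
  by exists H => //; apply: subset_trans (proper_sub ltKS).
exists S => //; split=> // K ltKS; apply: boolp.contrapT => nonilK.
by apply: noK; exists K.
Qed.

(** For a pair P, Q the group P Q is not sigma-nilpotent, so it has a critical subgroup H. As H ∩ P
    is a normal p-subgroup of q-power index, H is sigma_k-nilpotent for all k <> i, so it fails to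
    be sigma_i-nilpotent. Thus H / F_i(H) is a non-trivial q-group. *)
Lemma pair_critical gT (X : {group gT}) i j p q :
  i <> j -> p \in sigma i -> q \in sigma j -> ~ no_pair p q X ->
  exists2 H : {group gT}, H \subset X /\ sigma_nilpotent_critical sigma H &
    ~~ (sigma j)^'.-nat #|H : pi_Fitting (sigma i) H|.
Proof.
move=> ne_ij pi qj nop.
have [P [Q [sPX sQX [pP qQ nPQ ncPQ]]]] : exists P Q : {group gT},
    [/\ P \subset X, Q \subset X
      & [/\ p.-group P, q.-group Q, Q \subset 'N(P) & ~ Q \subset 'C(P)]].
  apply: boolp.contrapT => noPQ; apply: nop => P Q sPX sQX pP qQ nPQ.
  by apply/idPn => /negP ncPQ; apply: noPQ; exists P, Q.
pose S := (P <*> Q)%G.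
have nPS : P <| S by rewrite /normal joing_subl join_subG normG.
have i'Q := block_group_disjoint (nesym ne_ij) qj qQ.
have nonilS : ~ sigma_nilpotent sigma S.
  (* In a sigma_i-nilpotent S the sigma_i'-group Q lies in O_{i'}(S), which meets P trivially; as P
     normalises this core, [P, Q] = 1. *)
  move/(sigma_nilpotentP sigma_part)/(_ i) => nilS; apply: ncPQ.
  have sQO : Q \subset 'O_(sigma i)^'(S).
    rewrite sub_Hall_pcore ?joing_subr //.
    by rewrite /pHall pcore_sub pcore_pgroup pnatNK.
  have iP : (sigma i).-group P.
    by apply: sub_in_pnat pP => r _; rewrite inE => /eqP->.
  have tiPO := coprime_TIg (pnat_coprime iP (pcore_pgroup (sigma i)^' S)).
  apply/commG1P/trivgP; rewrite -tiPO /= commGC commg_subI // subsetI ?subxx ?sQO //.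
  by rewrite (subset_trans (joing_subl P Q)) ?gFnorm.
have [H sHS critH] := sigma_nilpotent_critical_exists nonilS.
exists H.
  by split=> //; apply: subset_trans sHS _; rewrite join_subG sPX.
pose R := (H :&: P)%G; have nRH : R <| H := normalGI sHS nPS.
have pR : p.-group R := pgroupS (subsetIr _ _) pP.
have qHR : q.-nat #|H : R|.
  rewrite indexgI; apply: pnat_dvd (index_dvd_normal nPS sHS) _.
  rewrite (index_mul_subgroup (A := Q)); last by rewrite /S /= joingC norm_joinEl.
  exact: pnat_dvd (dvdn_indexg _ _) qQ.
have nil_k k : k <> i -> pi_nilpotent (sigma k) H.
  move=> ne_ki; have k'R := block_group_disjoint (nesym ne_ki) pi pR.
  have [kj | ne_kj] := boolp.EM (k = j).
    apply: (pi_nilpotentI nRH k'R); rewrite kj.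
    by apply: sub_in_pnat qHR => r _; rewrite inE => /eqP->.
  apply: (pi_nilpotentI (normal_refl H)); last by rewrite indexgg.
  rewrite /pgroup -(Lagrange (normal_sub nRH)) pnatM [_.-nat #|R|]k'R.
  apply: sub_in_pnat qHR => r _; rewrite inE => /eqP->.
  exact: (block_disjoint sigma_part (nesym ne_kj) qj).
have nonil_i : ~~ pi_nilpotent (sigma i) H.
  apply/negP => nil_i; case: critH => nonilH _; apply: nonilH.
  by apply/(sigma_nilpotentP sigma_part) => k; have [-> | /nil_k] := boolp.EM (k = i).
have qHF : q.-nat #|H : pi_Fitting (sigma i) H|.
  apply: pnat_dvd qHR; apply: indexgS; apply: pi_Fitting_max nRH _.
  apply: (pi_nilpotentI (normal1 R)); rewrite ?pgroup1 // indexg1.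
  by apply: sub_in_pnat pR => r _; rewrite inE => /eqP->.
apply: contra nonil_i => j'HF; rewrite -pi_Fitting_id eqEsubset.
rewrite (normal_sub (pi_Fitting_normal _ _)) -indexg_eq1 /=.
apply/eqP; apply: (pnat_1 qHF); apply: sub_in_pnat j'HF => r _; rewrite !inE.
by apply: contraNneq => ->.
Qed.

Lemma edges_Vasilev_Murashko_graph gT (X : {group gT}) i j :
  primary_series sigma X ->
  edges (Vasilev_Murashko_graph sigma X) (i, j) <->
  i <> j /\ exists p q, [/\ p \in sigma i, q \in sigma j & ~ no_pair p q X].
Proof.
move=> serX; split=> [[_ _ [H [sHX critH _ [F /(is_block_FittingP sigma_part)-> jHF]]]] | ].
  have [|ne_ij [p [q [pi qj nop]]]] :=
      critical_no_pair (i := i) (j := j) (primary_series_sub serX sHX) critH.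
    move/(sigma_setE _ _ (cardG_gt0 _)): jHF.
    by rewrite card_quotient // normal_norm ?pi_Fitting_normal.
  by split=> //; exists p, q; split=> // noX; apply: nop; apply: no_pair_sub noX.
case=> ne_ij [p [q [pi qj nop]]].
have [H [sHX critH] jHF] := pair_critical ne_ij pi qj nop.
have iH : ~~ (sigma i)^'.-nat #|H|.
  apply: contra jHF => i'H.
  have /eqP-> : pi_Fitting (sigma i) H == H; last by rewrite indexgg.
  by rewrite pi_Fitting_id; apply: (pi_nilpotentI (normal_refl H)); rewrite ?indexgg.
split=> /=.
- apply/sigma_setE => //; apply: contra iH; exact: pnat_dvd (cardSg sHX).
- apply/sigma_setE => //; apply: contra jHF; apply: pnat_dvd.
  exact: dvdn_trans (dvdn_indexg _ _) (cardSg sHX).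
exists H; split=> //; first exact/sigma_setE.
exists (pi_Fitting_group (sigma i) H); first exact/is_block_FittingP.
apply/sigma_setE; rewrite ?cardG_gt0 //= card_quotient //.
exact: normal_norm (pi_Fitting_normal _ _).
Qed.

(** The block sigma_i omits q and every other block omits p, so each factor of the series is a q'-
    or a p'-group. *)
Lemma primary_series_Hall_dominated gT (G : {group gT}) i j p q :
  i <> j -> p \in sigma i -> q \in sigma j -> primary_series sigma G ->
  Hall_dominated (pair_pred p q) G.
Proof.
move=> ne_ij pi qj serG; apply: pair_Hall_dominated.
apply: primary_series_weaken serG => k; have [-> | ne_ki] := boolp.EM (k = i).
  exists false => r ri; rewrite inE /=; apply: contraPneq ri => ->.
  exact/negP/(block_disjoint sigma_part (nesym ne_ij)).
exists true => r rk; rewrite inE /=; apply: contraPneq rk => ->.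
exact/negP/(block_disjoint sigma_part (nesym ne_ki)).
Qed.

Lemma Vasilev_Murashko_graph_factorization gT (G A B C : {group gT}) :
  A * B = G -> B * C = G -> A * C = G -> sigma_soluble sigma G ->
  digraph_union
    (digraph_union (Vasilev_Murashko_graph sigma A) (Vasilev_Murashko_graph sigma B))
    (Vasilev_Murashko_graph sigma C) = Vasilev_Murashko_graph sigma G.
Proof.
move=> defAB defBC defAC /sigma_soluble_primary_series serG.
have [sAG sBG] : A \subset G /\ B \subset G by rewrite -defAB mulG_subl mulG_subr.
have sCG : C \subset G by rewrite -defAC mulG_subr.
have [serA serB serC] : [/\ primary_series sigma A, primary_series sigma B
    & primary_series sigma C] by split; apply: primary_series_sub serG _.
apply: digraph_ext => [i | i j]; first exact: vertices_trifactorization.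
split=> [E | /(edges_Vasilev_Murashko_graph _ _ serG)[ne_ij [p [q [pi qj nop]]]]].
  have edge_sub (X : {group gT}) : X \subset G -> primary_series sigma X ->
      edges (Vasilev_Murashko_graph sigma X) (i, j) ->
      edges (Vasilev_Murashko_graph sigma G) (i, j).
    move=> sXG serX /(edges_Vasilev_Murashko_graph _ _ serX)[ne_ij [p [q [pi qj nop]]]].
    apply/(edges_Vasilev_Murashko_graph _ _ serG); split=> //; exists p, q; split=> //.
    by move=> noG; apply: nop; apply: no_pair_sub noG.
  by case: E => [[]|]; apply: edge_sub.
apply: boolp.contrapT => noE; apply: nop.
have no_edge (X : {group gT}) : primary_series sigma X ->
    ~ edges (Vasilev_Murashko_graph sigma X) (i, j) -> no_pair p q X.
  move=> serX noX; apply: boolp.contrapT => nop; apply: noX.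
  by apply/(edges_Vasilev_Murashko_graph _ _ serX); split=> //; exists p, q.
have ne_pq : p != q.
  by apply/eqP => pq; apply: ne_ij; apply: (block_inj sigma_part pi); rewrite pq.
have domX := primary_series_Hall_dominated ne_ij pi qj.
apply: (no_pair_factorization ne_pq defAB defBC defAC);
  try by apply: domX.
- by apply: no_edge serA _ => E; apply: noE; left; left.
- by apply: no_edge serB _ => E; apply: noE; left; right.
- by apply: no_edge serC _ => E; apply: noE; right.
Qed.

End VasilevMurashko.

Theorem theorem1p7 (I : Type) (sigma : I -> nat_pred)
    (sigma_part : prime_partition sigma)
    (gT : finGroupType) (G A B C : {group gT})
    (ntG : G :!=: 1%g)
    (sAG : A \subset G) (sBG : B \subset G) (sCG : C \subset G)
    (defAB : (A * B)%g = G) (defBC : (B * C)%g = G) (defAC : (A * C)%g = G)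
    (solA : sigma_soluble sigma A) (solB : sigma_soluble sigma B)
    (solC : sigma_soluble sigma C) :
  (sigma_soluble sigma G ->
     digraph_union
       (digraph_union (Vasilev_Murashko_graph sigma A)
                      (Vasilev_Murashko_graph sigma B))
       (Vasilev_Murashko_graph sigma C)
     = Vasilev_Murashko_graph sigma G) /\
  (sigma_coprime sigma #|G : A|%g #|G : B|%g ->
   sigma_coprime sigma #|G : B|%g #|G : C|%g ->
   sigma_coprime sigma #|G : A|%g #|G : C|%g ->
     digraph_union
       (digraph_union (Hawkes_graph sigma A) (Hawkes_graph sigma B))
       (Hawkes_graph sigma C)
     = Hawkes_graph sigma G).
Proof.
split=> [solG | coAB coBC coAC].
  exact: Vasilev_Murashko_graph_factorization.
exact: Hawkes_graph_factorization.
Qed.
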